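(* For any $A : \mathcal U$ and $B : \sqrt{}\,\mathcal U$ (in an arbitrary ambient context), there is an equivalence $$\sqrt{}_{L}\Big(\big(\prod_{t:\mathbb T} A\langle t/L\rangle\big) \to B_{\downarrow}\Big) \;\longrightarrow\; \big(A \to \sqrt{}_{L}\, B_{\downarrow}\big),$$ where in both places $B_\downarrow$ denotes $\mathsf{ev}(i.\,B\langle i/L\rangle)$.
   Context: Ambient type theory: intensional Martin-Löf type theory with dependent products and sums (with definitional $\beta$ and $\eta$), identity types, and a hierarchy of universes written $\mathcal U$ (levels implicit). $\equiv$ is definitional equality. A vector such as $\vec t/L$ abbreviates a sequence $t_1/L_1,\dots,t_n/L_n$. The theory is extended as follows. (1) There is a closed type $\mathbb T$. (2) If $\Gamma$ is a context, so is $\Gamma,\mathsf{lock}_L$, where $L$ is a fresh lock name. (Binders extend the context on the right.) (3) Variables: if $L_1,\dots,L_n$ are the locks occurring (in order) in $\Gamma'$, and $\Gamma,x:A,\Gamma'\vdash t_m:\mathbb T$ for each $m$, then $\Gamma,x:A,\Gamma'\vdash x\langle \vec t/L\rangle : A[\vec t/\mathsf{key}_L]$. (With no locks this is the usual rule.) (4) Counit (admissible): from $\Gamma,\Gamma''\vdash a:A$ and a term $\Gamma,\Gamma'\vdash t_m:\mathbb T$ for each lock $L_m$ of $\Gamma'$, one gets $\Gamma,\Gamma',\Gamma''[\vec t/\mathsf{key}_L]\vdash a[\vec t/\mathsf{key}_L]:A[\vec t/\mathsf{key}_L]$. It commutes with all type and term formers; on variables, for $x$ in $\Gamma$ with $J$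 the locks of $\Gamma$ after $x$ and $K$ the locks of $\Gamma''$, $x\langle \vec j/J,\vec k/K\rangle[\vec t/\mathsf{key}_L]:\equiv x\langle \vec j[\vec t/\mathsf{key}_L]/J,\ \vec t\,[\vec k[\vec t/\mathsf{key}_L]/\mathsf{key}_K]/L,\ \vec k[\vec t/\mathsf{key}_L]/K\rangle$; for $x$ in $\Gamma''$ (in particular bound), $x\langle\vec k/K\rangle[\vec t/\mathsf{key}_L]:\equiv x\langle\vec k[\vec t/\mathsf{key}_L]/K\rangle$. (5) Substitution: $(y\langle\vec t/L\rangle)[a/x]:\equiv y\langle\vec t[a/x]/L\rangle$ for $y\neq x$, and $(x\langle\vec t/L\rangle)[a/x]:\equiv a[\vec t[a/x]/\mathsf{key}_L]$. (6) Unit (admissible): from $\Gamma,i:\mathbb T,\mathsf{lock}_L,\Gamma'\vdash a:A$ one gets $\Gamma,\Gamma'[i./\mathsf{lock}_L]\vdash a[i./\mathsf{lock}_L]:A[i./\mathsf{lock}_L]$. It commutes with all formers; on variables, $i\langle t/L,\vec k/K\rangle\mapsto t[i./\mathsf{lock}_L]$; for $x$ in $\Gamma$, $x\langle\vec j/J,t/L,\vec k/K\rangle\mapsto x\langle\vec j[i./\mathsf{lock}_L]/J,\vec k[i./\mathsf{lock}_L]/K\rangle$; for $x$ in $\Gamma'$ or bound, $x\langle\vec k/K\rangle\mapsto x\langle\vec k[i./\mathsf{lock}_L]/K\rangle$. (7) Type former $\sqrt{}$ (right adjoint to $\mathsf{lock}$): if $\Gamma,\mathsf{lock}_L\vdash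 A:\mathcal U$ then $\Gamma\vdash\sqrt{}_L A:\mathcal U$; if $\Gamma,\mathsf{lock}_L\vdash a:A$ then $\Gamma\vdash \mathsf{lock}_L.\,a:\sqrt{}_L A$; if $\Gamma,i:\mathbb T\vdash r:\sqrt{}_L A$ then $\Gamma\vdash\mathsf{ev}(i.\,r):A[i./\mathsf{lock}_L]$ ($i$ bound in $r$). Computation: $\mathsf{ev}(i.\,\mathsf{lock}_L.\,a)\equiv a[i./\mathsf{lock}_L]$; $\eta$: $r\equiv\mathsf{lock}_L.\,\mathsf{ev}(i.\,r[i/\mathsf{key}_L])$. The lock name is omitted when unused (e.g. $\sqrt{}\,\mathcal U$). *)

(* Defs.v *)
From Stdlib Require Import List Arith.
Import ListNotations.

(** Raw syntax.

    Variables are de Bruijn indices that count only the variables of the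
    context, not its locks.  [Var n ts] is x<ts/L>: the keys [ts] are listed in
    the order of the locks L to the right of x, outermost lock first.  Lock
    names are not needed: a lock is determined by its position. *)

Inductive op : Set :=
| oU (i : nat) | oT
| oPi | oLam | oApp
| oSig | oPair | oFst | oSnd
| oId | oRefl | oJ
| oSqrt | oLock | oEv.

(** For every argument of an operator, the numbers of variables and of locks
    that it binds. *)
Definition arity (o : op) : list (nat * nat) :=
  match o with
  | oU _ | oT => []
  | oPi | oSig => [(0, 0); (1, 0)]
  | oLam => [(1, 0)]
  | oApp | oPair => [(0, 0); (0, 0)]
  | oFst | oSnd | oRefl => [(0, 0)]
  | oId => [(0, 0); (0, 0); (0, 0)]
  | oJ => [(2, 0); (0, 0); (0, 0)]
  | oSqrt | oLock => [(0, 1)]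
  | oEv => [(1, 0)]
  end.

Inductive tm : Set :=
| Var (n : nat) (ts : list tm)
| Op (o : op) (args : list tm).

Notation U i := (Op (oU i) []).
Notation T := (Op oT []).
Notation Pi A B := (Op oPi [A; B]).
Notation Lam b := (Op oLam [b]).
Notation App f a := (Op oApp [f; a]).
Notation Sig A B := (Op oSig [A; B]).
Notation Pair a b := (Op oPair [a; b]).
Notation Fst p := (Op oFst [p]).
Notation Snd p := (Op oSnd [p]).
Notation Id A a b := (Op oId [A; a; b]).
Notation Refl a := (Op oRefl [a]).
(** Based path induction: [C] binds the free endpoint and the path to it. *)
Notation J C d p := (Op oJ [C; d; p]).
Notation Sqrt A := (Op oSqrt [A]).
Notation Lock a := (Op oLock [a]).
Notation Ev r := (Op oEv [r]).

(** A variable with no locks to its right. *)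
Notation var n := (Var n []).

(** The head of the list is the rightmost entry of the context. *)
Inductive entry : Set :=
| cvar (A : tm)
| clock.

Definition ctx := list entry.

Fixpoint nvars (G : ctx) : nat :=
  match G with
  | [] => 0
  | cvar _ :: G => S (nvars G)
  | clock :: G => nvars G
  end.

Fixpoint nlocks (G : ctx) : nat :=
  match G with
  | [] => 0
  | cvar _ :: G => nlocks G
  | clock :: G => S (nlocks G)
  end.

Definition under (v l : nat) (o : op) : list (nat * nat) :=
  map (fun b => (v + fst b, l + snd b)) (arity o).

Definition everywhere (v l : nat) (ts : list tm) : list (nat * nat) :=
  map (fun _ => (v, l)) ts.

(** Silent weakening by [w] variables and no locks, inserted to the left of
    the last [v] variables. *)
Fixpoint shift (w v : nat) (t : tm) : tm :=
  match t with
  | Var n ts => Var (if n <? v then n else n + w) (map (shift w v) ts)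
  | Op o ts =>
      Op o ((fix go (ts : list tm) (bs : list (nat * nat)) : list tm :=
               match ts, bs with
               | t :: ts, b :: bs => shift w (v + fst b) t :: go ts bs
               | _, _ => []
               end) ts (arity o))
  end.

Notation wk w t := (shift w 0 t).

(** The counit, substitution and the unit are given as the graphs of the
    operations defined by their clauses.  The clauses are not a structural
    recursion: the key inserted at a variable, or the term substituted for it,
    is itself subjected to a counit whose keys are results of the recursion. *)

(** [lock_counit w ts v l a a']: a[ts/key_L] is a', where G, G'' |- a, the
    context G' has [w] variables and one lock for each element of [ts], the
    [ts] live in G, G', and G'' has [v] variables and [l] locks. *)
Inductive lock_counit (w : nat) (ts : list tm) : nat -> nat -> tm -> tm -> Prop :=
| lock_counit_bound v l n ks ks' :
    n < v ->
    lock_counits w ts (everywhere v l ks) ks ks' ->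
    lock_counit w ts v l (Var n ks) (Var n ks')
| lock_counit_free v l n js js' ks ks' ts' :
    v <= n ->
    length ks = l ->
    lock_counits w ts (everywhere v l js) js js' ->
    lock_counits w ts (everywhere v l ks) ks ks' ->
    lock_counits v ks' (everywhere 0 0 ts) ts ts' ->
    lock_counit w ts v l (Var n (js ++ ks)) (Var (n + w) (js' ++ ts' ++ ks'))
| lock_counit_op v l o args args' :
    lock_counits w ts (under v l o) args args' ->
    lock_counit w ts v l (Op o args) (Op o args')
with lock_counits (w : nat) (ts : list tm) :
  list (nat * nat) -> list tm -> list tm -> Prop :=
| lock_counits_nil : lock_counits w ts [] [] []
| lock_counits_cons v l bs a a' args args' :
    lock_counit w ts v l a a' ->
    lock_counits w ts bs args args' ->
    lock_counits w ts ((v, l) :: bs) (a :: args) (a' :: args').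

(** [subst a v l b b']: b[a/x] is b', where G |- a : A and G, x:A, G' |- b and
    G' has [v] variables and [l] locks. *)
Inductive subst (a : tm) : nat -> nat -> tm -> tm -> Prop :=
| subst_lt v l n ks ks' :
    n < v ->
    substs a (everywhere v l ks) ks ks' ->
    subst a v l (Var n ks) (Var n ks')
| subst_eq v l ks ks' a' :
    length ks = l ->
    substs a (everywhere v l ks) ks ks' ->
    lock_counit v ks' 0 0 a a' ->
    subst a v l (Var v ks) a'
| subst_gt v l n ks ks' :
    v <= n ->
    substs a (everywhere v l ks) ks ks' ->
    subst a v l (Var (S n) ks) (Var n ks')
| subst_op v l o args args' :
    substs a (under v l o) args args' ->
    subst a v l (Op o args) (Op o args')
with substs (a : tm) : list (nat * nat) -> list tm -> list tm -> Prop :=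
| substs_nil : substs a [] [] []
| substs_cons v l bs b b' args args' :
    subst a v l b b' ->
    substs a bs args args' ->
    substs a ((v, l) :: bs) (b :: args) (b' :: args').

(** [lock_unit v l a a']: a[i./lock_L] is a', where G, i:T, lock_L, G' |- a
    and G' has [v] variables and [l] locks. *)
Inductive lock_unit : nat -> nat -> tm -> tm -> Prop :=
| lock_unit_lt v l n ks ks' :
    n < v ->
    lock_units (everywhere v l ks) ks ks' ->
    lock_unit v l (Var n ks) (Var n ks')
| lock_unit_eq v l t t' ks :
    length ks = l ->
    lock_unit v l t t' ->
    lock_unit v l (Var v (t :: ks)) t'
| lock_unit_gt v l n js js' t ks ks' :
    v <= n ->
    length ks = l ->
    lock_units (everywhere v l js) js js' ->
    lock_units (everywhere v l ks) ks ks' ->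
    lock_unit v l (Var (S n) (js ++ t :: ks)) (Var n (js' ++ ks'))
| lock_unit_op v l o args args' :
    lock_units (under v l o) args args' ->
    lock_unit v l (Op o args) (Op o args')
with lock_units : list (nat * nat) -> list tm -> list tm -> Prop :=
| lock_units_nil : lock_units [] [] []
| lock_units_cons v l bs a a' args args' :
    lock_unit v l a a' ->
    lock_units bs args args' ->
    lock_units ((v, l) :: bs) (a :: args) (a' :: args').

Scheme lock_counit_mind := Minimality for lock_counit Sort Prop
  with lock_counits_mind := Minimality for lock_counits Sort Prop.

(** [shift] is the counit for a G' without locks. *)
Lemma lock_counit_shift (w v l : nat) (a a' : tm) :
  lock_counit w [] v l a a' -> a' = shift w v a.
Proof.
  intros H.
  refine (lock_counit_mind
    (fun w ts v _ a a' => ts = [] -> a' = shift w v a)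
    (fun w ts bs args args' => ts = [] ->
       (forall v l, bs = everywhere v l args -> args' = map (shift w v) args) /\
       (forall v l ar, bs = map (fun b => (v + fst b, l + snd b)) ar ->
          args' = (fix go (ts : list tm) (bs : list (nat * nat)) : list tm :=
                     match ts, bs with
                     | t :: ts, b :: bs => shift w (v + fst b) t :: go ts bs
                     | _, _ => []
                     end) args ar)) _ _ _ _ _ w [] v l a a' H eq_refl);
    clear; intros w ts.
  - intros v l n ks ks' Hn _ IH E; simpl; destruct (IH E) as [IH' _].
    apply Nat.ltb_lt in Hn; rewrite Hn; f_equal; now apply (IH' v l).
  - intros v l n js js' ks ks' ts' Hn _ _ IHj _ IHk Hts _ E; simpl.
    destruct (IHj E) as [IHj' _], (IHk E) as [IHk' _]; subst ts.
    apply Nat.ltb_ge in Hn; rewrite Hn; inversion Hts; subst ts'; simpl.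
    rewrite map_app; f_equal; f_equal;
      [now apply (IHj' v l) | now apply (IHk' v l)].
  - intros v l o args args' _ IH E; simpl; destruct (IH E) as [_ IH'].
    f_equal; now apply (IH' v l).
  - intros _; split; [reflexivity |].
    intros v l [|b ar]; [reflexivity | discriminate].
  - intros v l bs a a' args args' _ IHa _ IH E.
    specialize (IHa E); destruct (IH E) as [IH1 IH2]; split.
    + intros v0 l0 E0; simpl in E0; injection E0 as Ev El E0; subst; simpl.
      f_equal; now apply (IH1 v0 l0).
    + intros v0 l0 [|b ar] E0; simpl in E0; [discriminate |].
      injection E0 as Ev El E0; subst; f_equal; now apply (IH2 v0 l0 ar).
Qed.

(** Judgements.  Universes are Russell-style and not cumulative; [keys G ts] and
    [keys_eq G ts ts'] say that all members of [ts] are terms of type T,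
    resp. are pairwise definitionally equal ones. *)

Reserved Notation "G ⊢ a ∈ A" (at level 70, a at next level, A at next level).
Reserved Notation "G ⊢ a ≡ b ∈ A"
  (at level 70, a at next level, b at next level, A at next level).

Inductive wf : ctx -> Prop :=
| wf_nil : wf []
| wf_cvar G A i : G ⊢ A ∈ U i -> wf (cvar A :: G)
| wf_clock G : wf G -> wf (clock :: G)

with has_type : ctx -> tm -> tm -> Prop :=
| ty_conv G a A B i :
    G ⊢ a ∈ A -> G ⊢ A ≡ B ∈ U i -> G ⊢ a ∈ B
| ty_Var G0 A G1 ts A' :
    wf (G1 ++ cvar A :: G0) ->
    length ts = nlocks G1 ->
    keys (G1 ++ cvar A :: G0) ts ->
    lock_counit (S (nvars G1)) ts 0 0 A A' ->
    (G1 ++ cvar A :: G0) ⊢ Var (nvars G1) ts ∈ A'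
| ty_U G i : wf G -> G ⊢ U i ∈ U (S i)
| ty_T G : wf G -> G ⊢ T ∈ U 0
| ty_Pi G A B i j :
    G ⊢ A ∈ U i -> (cvar A :: G) ⊢ B ∈ U j -> G ⊢ Pi A B ∈ U (max i j)
| ty_Lam G A B b i :
    G ⊢ A ∈ U i -> (cvar A :: G) ⊢ b ∈ B -> G ⊢ Lam b ∈ Pi A B
| ty_App G A B B' f a :
    G ⊢ f ∈ Pi A B -> G ⊢ a ∈ A -> subst a 0 0 B B' -> G ⊢ App f a ∈ B'
| ty_Sig G A B i j :
    G ⊢ A ∈ U i -> (cvar A :: G) ⊢ B ∈ U j -> G ⊢ Sig A B ∈ U (max i j)
| ty_Pair G A B B' a b j :
    (cvar A :: G) ⊢ B ∈ U j ->
    G ⊢ a ∈ A -> subst a 0 0 B B' -> G ⊢ b ∈ B' ->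
    G ⊢ Pair a b ∈ Sig A B
| ty_Fst G A B p : G ⊢ p ∈ Sig A B -> G ⊢ Fst p ∈ A
| ty_Snd G A B B' p :
    G ⊢ p ∈ Sig A B -> subst (Fst p) 0 0 B B' -> G ⊢ Snd p ∈ B'
| ty_Id G A a b i :
    G ⊢ A ∈ U i -> G ⊢ a ∈ A -> G ⊢ b ∈ A -> G ⊢ Id A a b ∈ U i
| ty_Refl G A a : G ⊢ a ∈ A -> G ⊢ Refl a ∈ Id A a a
| ty_J G A a b p C d j C1 C1' C2 C2' :
    (cvar (Id (wk 1 A) (wk 1 a) (var 0)) :: cvar A :: G) ⊢ C ∈ U j ->
    G ⊢ a ∈ A -> G ⊢ b ∈ A -> G ⊢ p ∈ Id A a b ->
    subst a 1 0 C C1 -> subst (Refl a) 0 0 C1 C1' ->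
    subst b 1 0 C C2 -> subst p 0 0 C2 C2' ->
    G ⊢ d ∈ C1' ->
    G ⊢ J C d p ∈ C2'
| ty_Sqrt G A i : (clock :: G) ⊢ A ∈ U i -> G ⊢ Sqrt A ∈ U i
| ty_Lock G A a : (clock :: G) ⊢ a ∈ A -> G ⊢ Lock a ∈ Sqrt A
| ty_Ev G A A' r :
    (cvar T :: G) ⊢ r ∈ Sqrt A -> lock_unit 0 0 A A' -> G ⊢ Ev r ∈ A'

with keys : ctx -> list tm -> Prop :=
| keys_nil G : keys G []
| keys_cons G t ts : G ⊢ t ∈ T -> keys G ts -> keys G (t :: ts)

with eq_tm : ctx -> tm -> tm -> tm -> Prop :=
| eqt_refl G a A : G ⊢ a ∈ A -> G ⊢ a ≡ a ∈ A
| eqt_sym G a b A : G ⊢ a ≡ b ∈ A -> G ⊢ b ≡ a ∈ A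
| eqt_trans G a b c A : G ⊢ a ≡ b ∈ A -> G ⊢ b ≡ c ∈ A -> G ⊢ a ≡ c ∈ A
| eqt_conv G a b A B i :
    G ⊢ a ≡ b ∈ A -> G ⊢ A ≡ B ∈ U i -> G ⊢ a ≡ b ∈ B
| eqt_Var G0 A G1 ts ts' A' :
    wf (G1 ++ cvar A :: G0) ->
    length ts = nlocks G1 ->
    keys_eq (G1 ++ cvar A :: G0) ts ts' ->
    lock_counit (S (nvars G1)) ts 0 0 A A' ->
    (G1 ++ cvar A :: G0) ⊢ Var (nvars G1) ts ≡ Var (nvars G1) ts' ∈ A'
| eqt_Pi G A A' B B' i j :
    G ⊢ A ∈ U i ->
    G ⊢ A ≡ A' ∈ U i -> (cvar A :: G) ⊢ B ≡ B' ∈ U j ->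
    G ⊢ Pi A B ≡ Pi A' B' ∈ U (max i j)
| eqt_Lam G A B b b' i :
    G ⊢ A ∈ U i -> (cvar A :: G) ⊢ b ≡ b' ∈ B ->
    G ⊢ Lam b ≡ Lam b' ∈ Pi A B
| eqt_App G A B B' f f' a a' :
    G ⊢ f ≡ f' ∈ Pi A B -> G ⊢ a ≡ a' ∈ A -> subst a 0 0 B B' ->
    G ⊢ App f a ≡ App f' a' ∈ B'
| eqt_Sig G A A' B B' i j :
    G ⊢ A ∈ U i ->
    G ⊢ A ≡ A' ∈ U i -> (cvar A :: G) ⊢ B ≡ B' ∈ U j ->
    G ⊢ Sig A B ≡ Sig A' B' ∈ U (max i j)
| eqt_Pair G A B B' a a' b b' j :
    (cvar A :: G) ⊢ B ∈ U j ->
    G ⊢ a ≡ a' ∈ A -> subst a 0 0 B B' -> G ⊢ b ≡ b' ∈ B' ->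
    G ⊢ Pair a b ≡ Pair a' b' ∈ Sig A B
| eqt_Fst G A B p p' : G ⊢ p ≡ p' ∈ Sig A B -> G ⊢ Fst p ≡ Fst p' ∈ A
| eqt_Snd G A B B' p p' :
    G ⊢ p ≡ p' ∈ Sig A B -> subst (Fst p) 0 0 B B' ->
    G ⊢ Snd p ≡ Snd p' ∈ B'
| eqt_Id G A A' a a' b b' i :
    G ⊢ A ≡ A' ∈ U i -> G ⊢ a ≡ a' ∈ A -> G ⊢ b ≡ b' ∈ A ->
    G ⊢ Id A a b ≡ Id A' a' b' ∈ U i
| eqt_Refl G A a a' :
    G ⊢ a ≡ a' ∈ A -> G ⊢ Refl a ≡ Refl a' ∈ Id A a a
| eqt_J G A a b p p' C C' d d' j C1 C1' C2 C2' :
    (cvar (Id (wk 1 A) (wk 1 a) (var 0)) :: cvar A :: G) ⊢ C ≡ C' ∈ U j ->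
    G ⊢ a ∈ A -> G ⊢ b ∈ A -> G ⊢ p ≡ p' ∈ Id A a b ->
    subst a 1 0 C C1 -> subst (Refl a) 0 0 C1 C1' ->
    subst b 1 0 C C2 -> subst p 0 0 C2 C2' ->
    G ⊢ d ≡ d' ∈ C1' ->
    G ⊢ J C d p ≡ J C' d' p' ∈ C2'
| eqt_Sqrt G A A' i :
    (clock :: G) ⊢ A ≡ A' ∈ U i -> G ⊢ Sqrt A ≡ Sqrt A' ∈ U i
| eqt_Lock G A a a' :
    (clock :: G) ⊢ a ≡ a' ∈ A -> G ⊢ Lock a ≡ Lock a' ∈ Sqrt A
| eqt_Ev G A A' r r' :
    (cvar T :: G) ⊢ r ≡ r' ∈ Sqrt A -> lock_unit 0 0 A A' ->
    G ⊢ Ev r ≡ Ev r' ∈ A'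
| eqt_Pi_beta G A B B' a b b' i :
    G ⊢ A ∈ U i -> (cvar A :: G) ⊢ b ∈ B -> G ⊢ a ∈ A ->
    subst a 0 0 b b' -> subst a 0 0 B B' ->
    G ⊢ App (Lam b) a ≡ b' ∈ B'
| eqt_Pi_eta G A B f :
    G ⊢ f ∈ Pi A B -> G ⊢ f ≡ Lam (App (wk 1 f) (var 0)) ∈ Pi A B
| eqt_Fst_beta G A B B' a b j :
    (cvar A :: G) ⊢ B ∈ U j ->
    G ⊢ a ∈ A -> subst a 0 0 B B' -> G ⊢ b ∈ B' ->
    G ⊢ Fst (Pair a b) ≡ a ∈ A
| eqt_Snd_beta G A B B' a b j :
    (cvar A :: G) ⊢ B ∈ U j ->
    G ⊢ a ∈ A -> subst a 0 0 B B' -> G ⊢ b ∈ B' ->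
    G ⊢ Snd (Pair a b) ≡ b ∈ B'
| eqt_Sig_eta G A B p :
    G ⊢ p ∈ Sig A B -> G ⊢ p ≡ Pair (Fst p) (Snd p) ∈ Sig A B
| eqt_J_beta G A a C d j C1 C1' :
    (cvar (Id (wk 1 A) (wk 1 a) (var 0)) :: cvar A :: G) ⊢ C ∈ U j ->
    G ⊢ a ∈ A ->
    subst a 1 0 C C1 -> subst (Refl a) 0 0 C1 C1' ->
    G ⊢ d ∈ C1' ->
    G ⊢ J C d (Refl a) ≡ d ∈ C1'
| eqt_Sqrt_beta G A A' a a' :
    (clock :: cvar T :: G) ⊢ a ∈ A -> lock_unit 0 0 a a' -> lock_unit 0 0 A A' ->
    G ⊢ Ev (Lock a) ≡ a' ∈ A'
| eqt_Sqrt_eta G A r r' :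
    G ⊢ r ∈ Sqrt A -> lock_counit 1 [var 0] 0 0 r r' ->
    G ⊢ r ≡ Lock (Ev r') ∈ Sqrt A

with keys_eq : ctx -> list tm -> list tm -> Prop :=
| keys_eq_nil G : keys_eq G [] []
| keys_eq_cons G t t' ts ts' :
    G ⊢ t ≡ t' ∈ T -> keys_eq G ts ts' ->
    keys_eq G (t :: ts) (t' :: ts')

where "G ⊢ a ∈ A" := (has_type G a A)
and "G ⊢ a ≡ b ∈ A" := (eq_tm G a b A).

Definition Arr (X Y : tm) : tm := Pi X (wk 1 Y).

Definition Prod (X Y : tm) : tm := Sig X (wk 1 Y).

(** (Σ (g : Y -> X), Π (y : Y), f (g y) = y) ×
    (Σ (h : Y -> X), Π (x : X), h (f x) = x) *)
Definition IsEquiv (X Y f : tm) : tm :=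
  Prod
    (Sig (Arr Y X)
       (Pi (wk 1 Y)
          (Id (wk 2 Y) (App (wk 2 f) (App (var 1) (var 0))) (var 0))))
    (Sig (Arr Y X)
       (Pi (wk 1 X)
          (Id (wk 2 X) (App (var 1) (App (wk 2 f) (var 0))) (var 0)))).

Definition Equiv (X Y : tm) : tm :=
  Sig (Arr X Y) (IsEquiv (wk 1 X) (wk 1 Y) (var 0)).

(* Main.v *)
(** In the internal language both composites are identities by computation.
    Write [lower f] for [ev(i. f<i/L>)], the transpose of [f : √_L C].  The maps are
      f |-> λa. lock_L. lower f (λt. a<t/L>)
      g |-> lock_L. λα. ev(i. g<i/L> (α i))
    and the β and η rules of Π and √ reduce both composites to the identity, so
    that reflexivity proves the homotopies.

    Neither map mentions A or B.  The equivalence is therefore derived with A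
    and B replaced by variables, where all types are concrete, then abstracted
    over them and applied to the given A and B.  Only the formation of the two
    types needs metatheory: typing is preserved by the counits whose keys are
    variables, which include weakening. *)

Require Import Defs.
From Stdlib Require Import List Arith Lia.
Import ListNotations.

(** The obstacle is that a counit below locks subjects its own keys to further counits. For a key
    that is a variable [p] with no lock to its right, this inner counit yields [p<k/K>], which is
    again a variable; counits with such keys therefore form a recursive function, [ren]. The keys
    [t] and [i] in the two types of the statement are of this kind. Typing is stable under [ren]
    because [ren] commutes with the three graphs that occur in the premises of the rules. That [ren]
    agrees with the graph requires every variable to carry as many keys as there are locks to its
    right. This is the reason for the predicate [scoped], which is tracked through all operations.
    No theorem on substitution into derivations is proved: A and B enter through [ty_App], whose
    side condition is a single instance of [subst] that can be computed. *)

Fixpoint tm_nested_ind (P : tm -> Prop)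
  (HVar : forall n ts, Forall P ts -> P (Var n ts))
  (HOp : forall o args, Forall P args -> P (Op o args)) (t : tm) : P t :=
  let fix go (ts : list tm) : Forall P ts :=
    match ts with
    | [] => Forall_nil P
    | t :: ts => Forall_cons t (tm_nested_ind P HVar HOp t) (go ts)
    end in
  match t with
  | Var n ts => HVar n ts (go ts)
  | Op o args => HOp o args (go args)
  end.

(** * Induction principles for the graphs *)

Inductive pointwise (R : nat -> nat -> tm -> tm -> Prop) :
  list (nat * nat) -> list tm -> list tm -> Prop :=
| pointwise_nil : pointwise R [] [] []
| pointwise_cons v l bs a a' args args' :
    R v l a a' -> pointwise R bs args args' ->
    pointwise R ((v, l) :: bs) (a :: args) (a' :: args').

Lemma pointwise_everywhere R v l ks ks0 ks' :
  length ks0 = length ks ->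
  pointwise R (everywhere v l ks0) ks ks' <-> Forall2 (R v l) ks ks'.
Proof.
  intros Hlen; split.
  - revert ks ks' Hlen; induction ks0; intros ks ks' Hlen H; inversion H; subst; auto.
  - intros H; revert ks0 Hlen; induction H; intros [|k0 ks0] Hlen; try discriminate;
      simpl; constructor; auto.
Qed.

Lemma lock_counits_pointwise w ts bs args args' :
  lock_counits w ts bs args args' <-> pointwise (lock_counit w ts) bs args args'.
Proof. split; induction 1; constructor; auto. Qed.

Lemma substs_pointwise a bs args args' :
  substs a bs args args' <-> pointwise (subst a) bs args args'.
Proof. split; induction 1; constructor; auto. Qed.

Lemma lock_units_pointwise bs args args' :
  lock_units bs args args' <-> pointwise lock_unit bs args args'.
Proof. split; induction 1; constructor; auto. Qed.

Lemma lock_counits_everywhere w ts v l ks ks' :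
  lock_counits w ts (everywhere v l ks) ks ks' <->
  Forall2 (lock_counit w ts v l) ks ks'.
Proof. rewrite lock_counits_pointwise; now apply pointwise_everywhere. Qed.

Lemma substs_everywhere a v l ks ks' :
  substs a (everywhere v l ks) ks ks' <-> Forall2 (subst a v l) ks ks'.
Proof. rewrite substs_pointwise; now apply pointwise_everywhere. Qed.

Lemma lock_units_everywhere v l ks ks' :
  lock_units (everywhere v l ks) ks ks' <-> Forall2 (lock_unit v l) ks ks'.
Proof. rewrite lock_units_pointwise; now apply pointwise_everywhere. Qed.

(** For [ks] and [ts] in the free case the graph is kept next to the induction hypothesis: scoping
    of [ks'] and commutation of the inner counit are read off from it later. *)
Lemma lock_counit_nested_ind
  (P : nat -> list tm -> nat -> nat -> tm -> tm -> Prop) :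
  (forall w ts v l n ks ks', n < v ->
     Forall2 (P w ts v l) ks ks' -> P w ts v l (Var n ks) (Var n ks')) ->
  (forall w ts v l n js js' ks ks' ts', v <= n -> length ks = l ->
     Forall2 (P w ts v l) js js' -> Forall2 (P w ts v l) ks ks' ->
     Forall2 (lock_counit w ts v l) ks ks' ->
     Forall2 (P v ks' 0 0) ts ts' -> Forall2 (lock_counit v ks' 0 0) ts ts' ->
     P w ts v l (Var n (js ++ ks)) (Var (n + w) (js' ++ ts' ++ ks'))) ->
  (forall w ts v l o args args',
     pointwise (P w ts) (under v l o) args args' ->
     P w ts v l (Op o args) (Op o args')) ->
  forall w ts v l a a', lock_counit w ts v l a a' -> P w ts v l a a'.
Proof.
  intros Hb Hf Ho.
  apply (lock_counit_mind P (fun w ts => pointwise (P w ts))).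
  - intros; apply Hb; auto; now apply pointwise_everywhere in H1.
  - intros w ts v l n js js' ks ks' ts' Hn Hl _ Hjs Hks0 Hks Hts0 Hts.
    apply pointwise_everywhere in Hjs, Hks, Hts; try reflexivity.
    apply lock_counits_everywhere in Hks0, Hts0.
    now apply Hf.
  - intros; now apply Ho.
  - constructor.
  - intros; now constructor.
Qed.

Scheme subst_mind := Minimality for subst Sort Prop
  with substs_mind := Minimality for substs Sort Prop.
Scheme lock_unit_mind := Minimality for lock_unit Sort Prop
  with lock_units_mind := Minimality for lock_units Sort Prop.

Lemma subst_nested_ind a (P : nat -> nat -> tm -> tm -> Prop) :
  (forall v l n ks ks', n < v ->
     Forall2 (P v l) ks ks' -> P v l (Var n ks) (Var n ks')) ->
  (forall v l ks ks' a', length ks = l -> Forall2 (P v l) ks ks' ->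
     lock_counit v ks' 0 0 a a' -> P v l (Var v ks) a') ->
  (forall v l n ks ks', v <= n ->
     Forall2 (P v l) ks ks' -> P v l (Var (S n) ks) (Var n ks')) ->
  (forall v l o args args', pointwise P (under v l o) args args' ->
     P v l (Op o args) (Op o args')) ->
  forall v l b b', subst a v l b b' -> P v l b b'.
Proof.
  intros Hl He Hg Ho; apply (subst_mind a P (pointwise P)).
  - intros; apply Hl; auto; now apply pointwise_everywhere in H1.
  - intros; eapply He; eauto; now apply pointwise_everywhere in H1.
  - intros; apply Hg; auto; now apply pointwise_everywhere in H1.
  - intros; now apply Ho.
  - constructor.
  - intros; now constructor.
Qed.

Lemma lock_unit_nested_ind (P : nat -> nat -> tm -> tm -> Prop) :
  (forall v l n ks ks', n < v ->
     Forall2 (P v l) ks ks' -> P v l (Var n ks) (Var n ks')) ->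
  (forall v l t t' ks, length ks = l -> P v l t t' ->
     P v l (Var v (t :: ks)) t') ->
  (forall v l n js js' t ks ks', v <= n -> length ks = l ->
     Forall2 (P v l) js js' -> Forall2 (P v l) ks ks' ->
     P v l (Var (S n) (js ++ t :: ks)) (Var n (js' ++ ks'))) ->
  (forall v l o args args', pointwise P (under v l o) args args' ->
     P v l (Op o args) (Op o args')) ->
  forall v l a a', lock_unit v l a a' -> P v l a a'.
Proof.
  intros Hl He Hg Ho; apply (lock_unit_mind P (pointwise P)).
  - intros; apply Hl; auto; now apply pointwise_everywhere in H1.
  - intros; now apply He.
  - intros; apply Hg; auto; eapply pointwise_everywhere; eauto.
  - intros; now apply Ho.
  - constructor.
  - intros; now constructor.
Qed.

(** * Counits with variable keys as a recursive function *)

Definition zipw (f : nat * nat -> tm -> tm) :=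
  fix go (ts : list tm) (bs : list (nat * nat)) : list tm :=
    match ts, bs with
    | t :: ts, b :: bs => f b t :: go ts bs
    | _, _ => []
    end.

Lemma zipw_ext f g ts bs :
  (forall b, Forall (fun t => f b t = g b t) ts) -> zipw f ts bs = zipw g ts bs.
Proof.
  revert bs; induction ts as [|t ts IH]; intros [|b bs] H; try reflexivity.
  simpl; f_equal.
  - specialize (H b); now inversion H.
  - apply IH; intros b'; specialize (H b'); now inversion H.
Qed.

Lemma zipw_zipw f g ts bs :
  zipw f (zipw g ts bs) bs = zipw (fun b t => f b (g b t)) ts bs.
Proof.
  revert bs; induction ts as [|t ts IH]; intros [|b bs]; simpl; f_equal; auto.
Qed.

Lemma pointwise_zipw (R R' : nat -> nat -> tm -> tm -> Prop) f g v l bs args args' :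
  (forall b a a', R (v + fst b) (l + snd b) a a' ->
     R' (v + fst b) (l + snd b) (f b a) (g b a')) ->
  pointwise R (map (fun b => (v + fst b, l + snd b)) bs) args args' ->
  pointwise R' (map (fun b => (v + fst b, l + snd b)) bs)
    (zipw f args bs) (zipw g args' bs).
Proof.
  intros H; revert args args'; induction bs as [|b bs IH]; intros args args' Ha;
    inversion Ha; subst; constructor; auto.
Qed.

(** The counit with keys [var p], for [p] in [ps].  It is a structural recursion
    because the counit of such a key is [Var p] applied to the new keys. *)
Fixpoint ren (w : nat) (ps : list nat) (v l : nat) (t : tm) : tm :=
  match t with
  | Var n ts =>
      let ts' := map (ren w ps v l) ts in
      if n <? v then Var n ts'
      else
        let js := firstn (length ts - l) ts' in
        let ks := skipn (length ts - l) ts' in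
        Var (n + w) (js ++ map (fun p => Var (p + v) ks) ps ++ ks)
  | Op o args =>
      Op o (zipw (fun b => ren w ps (fst b + v) (snd b + l)) args (arity o))
  end.

Lemma ren_bound w ps v l n ts :
  n < v -> ren w ps v l (Var n ts) = Var n (map (ren w ps v l) ts).
Proof. intros H; apply Nat.ltb_lt in H; simpl; now rewrite H. Qed.

Lemma ren_free w ps v l n js ks :
  v <= n -> length js = length (js ++ ks) - l ->
  ren w ps v l (Var n (js ++ ks)) =
    Var (n + w) (map (ren w ps v l) js ++
      map (fun p => Var (p + v) (map (ren w ps v l) ks)) ps ++
      map (ren w ps v l) ks).
Proof.
  intros H E; apply Nat.ltb_ge in H; simpl; rewrite H, <- E, map_app.
  rewrite firstn_app, skipn_app, length_map, Nat.sub_diag; simpl.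
  rewrite firstn_all2, skipn_all2 by (rewrite length_map; lia).
  now rewrite app_nil_r.
Qed.

(** Truncated subtraction makes the split exist even if [ts] has fewer than [l] elements, with [js]
    empty. Thus commutation of [ren] with the other operations needs no scoping. *)
Lemma split_at_end (X : Type) (l : nat) (ts : list X) :
  exists js ks, ts = js ++ ks /\ length js = length ts - l.
Proof.
  exists (firstn (length ts - l) ts), (skipn (length ts - l) ts); split.
  - now rewrite firstn_skipn.
  - rewrite length_firstn; lia.
Qed.

Lemma split_at_end_length (X : Type) (l : nat) (ts : list X) :
  l <= length ts -> exists js ks, ts = js ++ ks /\ length ks = l.
Proof.
  intros H; destruct (split_at_end X l ts) as (js & ks & -> & E).
  exists js, ks; split; auto; rewrite length_app in *; lia.
Qed.

Lemma app_eq_app_length (X : Type) (x1 x2 y1 y2 : list X) :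
  length x1 = length y1 -> x1 ++ x2 = y1 ++ y2 -> x1 = y1 /\ x2 = y2.
Proof.
  revert y1; induction x1 as [|x x1 IH]; intros [|y y1] L E; try discriminate; auto.
  injection L as L; injection E as -> E.
  destruct (IH y1 L E) as [-> ->]; auto.
Qed.

Lemma Forall2_map_both (X Y : Type) (R : Y -> Y -> Prop) (f g : X -> Y) xs ys :
  Forall2 (fun x y => R (f x) (g y)) xs ys -> Forall2 R (map f xs) (map g ys).
Proof. induction 1; simpl; auto. Qed.

Lemma Forall2_diagonal (X : Type) (R : X -> X -> Prop) xs :
  (forall x, R x x) -> Forall2 R xs xs.
Proof. intros H; induction xs; auto. Qed.

Section counit_ren.
Variables (W : nat) (ps : list nat).
Notation θ := (ren W ps).

(** The two insertions are disjoint: [ren] inserts to the left of [v0] variables which themselves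
    lie to the left of the [w] new ones. *)
Lemma shift_ren w v v0 l a :
  ren W ps (v + w + v0) l (shift w v a) = shift w v (ren W ps (v + v0) l a).
Proof.
  revert v l; induction a as [n ts IH|o args IH] using tm_nested_ind; intros v l.
  - destruct (split_at_end _ l ts) as (js & ks & -> & E).
    assert (Hm : forall us, Forall (fun a => forall v l,
        θ (v + w + v0) l (shift w v a) = shift w v (θ (v + v0) l a)) us ->
        map (θ (v + w + v0) l) (map (shift w v) us)
        = map (shift w v) (map (θ (v + v0) l) us)).
    { intros us H; rewrite !map_map; apply map_ext_Forall.
      eapply Forall_impl; [|apply H]; simpl; auto. }
    destruct (proj1 (Forall_app _ _ _) IH) as [IHj IHk].
    apply Hm in IHj, IHk; apply Hm in IH.
    change (shift w v (Var n (js ++ ks))) with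
      (Var (if n <? v then n else n + w) (map (shift w v) (js ++ ks))).
    destruct (Nat.ltb_spec n (v + v0)) as [Hn|Hn].
    + rewrite !ren_bound by (destruct (n <? v); lia).
      simpl; f_equal; auto.
    + destruct (Nat.ltb_spec n v) as [?|_]; [lia|].
      rewrite map_app.
      rewrite !ren_free by (rewrite ?length_app, ?length_map in *; lia).
      simpl; destruct (Nat.ltb_spec (n + W) v) as [?|_]; [lia|].
      f_equal; [lia|].
      rewrite !map_app, IHj, IHk; f_equal; f_equal.
      rewrite (map_map _ _ ps); apply map_ext; intros p; simpl.
      destruct (Nat.ltb_spec (p + (v + v0)) v) as [?|_]; [lia|].
      f_equal; lia.
  - simpl; f_equal.
    change (zipw (fun b => θ (fst b + (v + w + v0)) (snd b + l))
      (zipw (fun b => shift w (v + fst b)) args (arity o)) (arity o)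
      = zipw (fun b => shift w (v + fst b))
          (zipw (fun b => θ (fst b + (v + v0)) (snd b + l)) args (arity o)) (arity o)).
    rewrite !zipw_zipw; apply zipw_ext; intros b.
    eapply Forall_impl; [|apply IH]; simpl; intros a Ha.
    replace (fst b + (v + w + v0)) with (v + fst b + w + v0) by lia.
    rewrite Ha; do 2 f_equal; lia.
Qed.

(** The renaming inserts further to the left than the counit; [v0] and [l0] count the entries
    between the two places. The keys [us] live in the context that ends with the block inserted by
    the counit, whence the offsets [w + v0] and [length us + l0] in their renaming. *)
Lemma lock_counit_ren w us v l a a' :
  lock_counit w us v l a a' -> forall v0 l0,
  lock_counit w (map (θ (w + v0) (length us + l0)) us) v l
    (θ (v + v0) (l + l0) a) (θ (v + w + v0) (l + length us + l0) a').
Proof.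
  revert w us v l a a'; apply (lock_counit_nested_ind (fun w us v l a a' => forall v0 l0,
    lock_counit w (map (θ (w + v0) (length us + l0)) us) v l
      (θ (v + v0) (l + l0) a) (θ (v + w + v0) (l + length us + l0) a'))).
  - intros w us v l n ks ks' Hn IH v0 l0.
    rewrite !ren_bound by lia.
    apply lock_counit_bound; auto.
    apply lock_counits_everywhere, Forall2_map_both.
    eapply Forall2_impl; [|apply IH]; intros ? ? H; apply H.
  - intros w us v l n js js' ks ks' us' Hn Hl IHj IHk _ IHu _ v0 l0.
    assert (Lj := Forall2_length IHj); assert (Lk := Forall2_length IHk).
    assert (Lu := Forall2_length IHu).
    set (US := map (θ (w + v0) (length us + l0)) us).
    set (f := θ (v + v0) (l + l0)).
    set (g := θ (v + w + v0) (l + length us + l0)).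
    assert (Hk : Forall2 (lock_counit w US v l) (map f ks) (map g ks')).
    { apply Forall2_map_both; eapply Forall2_impl; [|apply IHk]; intros ? ? H; apply H. }
    assert (Hj : Forall2 (lock_counit w US v l) (map f js) (map g js')).
    { apply Forall2_map_both; eapply Forall2_impl; [|apply IHj]; intros ? ? H; apply H. }
    assert (Hu : Forall2 (lock_counit v (map g ks') 0 0) US (map g us')).
    { apply Forall2_map_both; eapply Forall2_impl; [|apply IHu]; simpl.
      intros u u' H; specialize (H (w + v0) (length us + l0)).
      unfold g; replace (v + w + v0) with (v + (w + v0)) by lia.
      rewrite <- Lk, Hl in H.
      now replace (l + length us + l0) with (l + (length us + l0)) by lia. }
    destruct (Nat.ltb_spec n (v + v0)) as [Hb|Hb].
    + unfold f, g; rewrite !ren_bound by lia; fold f; fold g.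
      rewrite !map_app.
      apply lock_counit_free; rewrite ?lock_counits_everywhere; auto.
      now rewrite length_map.
    (* A variable to the left of both places: [j1] belongs to the locks left of the renaming, [j2]
       to those between the two places, [ks] to those right of the counit. *)
    + destruct (split_at_end _ l0 js) as (j1 & j2 & -> & E).
      destruct (Forall2_app_inv_l _ _ IHj) as (j1' & j2' & H1 & H2 & ->).
      assert (L1 := Forall2_length H1); assert (L2 := Forall2_length H2).
      rewrite !map_app in Hj.
      destruct (Forall2_app_inv_l _ _ Hj) as (m1 & m2 & Hj1 & Hj2 & Em).
      apply app_eq_app_length in Em as [<- <-];
        [|now rewrite length_map, <- L1, <- (Forall2_length Hj1), length_map].
      unfold f, g.
      replace ((j1 ++ j2) ++ ks) with (j1 ++ (j2 ++ ks)) by now rewrite app_assoc.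
      replace ((j1' ++ j2') ++ us' ++ ks') with (j1' ++ (j2' ++ us' ++ ks'))
        by now rewrite app_assoc.
      rewrite !ren_free by (rewrite ?length_app in *; lia).
      fold f; fold g; rewrite !map_app.
      set (P := map (fun p => Var (p + (v + v0)) (map f j2 ++ map f ks)) ps).
      set (P' := map (fun p => Var (p + (v + w + v0))
        (map g j2' ++ map g us' ++ map g ks')) ps).
      (* A key inserted by [ren] is a variable applied to the keys that follow it, so the counit
         treats it like any other free variable. *)
      enough (HP : Forall2 (lock_counit w US v l) P P').
      { replace (n + w + W) with (n + W + w) by lia.
        replace (map f j1 ++ P ++ map f j2 ++ map f ks)
          with ((map f j1 ++ P ++ map f j2) ++ map f ks) by now rewrite <- !app_assoc.
        replace (map g j1' ++ P' ++ map g j2' ++ map g us' ++ map g ks')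
          with ((map g j1' ++ P' ++ map g j2') ++ map g us' ++ map g ks')
          by now rewrite <- !app_assoc.
        apply lock_counit_free; rewrite ?lock_counits_everywhere; auto;
          try lia; try (now rewrite length_map).
        repeat apply Forall2_app; auto. }
      apply Forall2_map_both.
      apply Forall2_diagonal; intros p.
      replace (p + (v + w + v0)) with (p + (v + v0) + w) by lia.
      apply lock_counit_free; rewrite ?lock_counits_everywhere; auto;
        try lia; try (now rewrite length_map).
  - intros w us v l o args args' IH v0 l0; simpl.
    apply lock_counit_op, lock_counits_pointwise.
    eapply pointwise_zipw; [|apply IH].
    intros b a a' H; simpl in H; specialize (H v0 l0).
    replace (fst b + (v + v0)) with (v + fst b + v0) by lia.
    replace (snd b + (l + l0)) with (l + snd b + l0) by lia.
    replace (fst b + (v + w + v0)) with (v + fst b + w + v0) by lia.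
    now replace (snd b + (l + length us + l0)) with (l + snd b + length us + l0) by lia.
Qed.

(** At the substituted variable the result is a counit of [a], so that case is an instance of
    [lock_counit_ren]. *)
Lemma subst_ren a v0 l0 v l b b' :
  subst a v l b b' ->
  subst (θ v0 l0 a) v l (θ (v + S v0) (l + l0) b) (θ (v + v0) (l + l0) b').
Proof.
  revert v l b b'; apply subst_nested_ind.
  - intros v l n ks ks' Hn IH.
    rewrite !ren_bound by lia.
    apply subst_lt; auto; now apply substs_everywhere, Forall2_map_both.
  - intros v l ks ks' a' Hl IH Ha; assert (Lk := Forall2_length IH).
    rewrite !ren_bound by lia.
    apply (lock_counit_ren) with (v0 := v0) (l0 := l0) in Ha.
    rewrite <- Lk, Hl in Ha.
    eapply subst_eq; [now rewrite length_map| |exact Ha].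
    now apply substs_everywhere, Forall2_map_both.
  - intros v l n ks ks' Hn IH.
    destruct (Nat.ltb_spec n (v + v0)) as [Hb|Hb].
    + rewrite !ren_bound by lia.
      apply subst_gt; auto; now apply substs_everywhere, Forall2_map_both.
    + destruct (split_at_end _ (l + l0) ks) as (j & k & -> & E).
      destruct (Forall2_app_inv_l _ _ IH) as (j' & k' & Hj & Hk & ->).
      assert (L1 := Forall2_length Hj); assert (L2 := Forall2_length Hk).
      rewrite !ren_free by (rewrite ?length_app in *; lia).
      apply Forall2_map_both in Hj, Hk.
      apply subst_gt; [lia|].
      apply substs_everywhere; repeat apply Forall2_app; auto.
      apply Forall2_map_both.
      apply Forall2_diagonal; intros p.
      replace (p + (v + S v0)) with (S (p + (v + v0))) by lia.
      apply subst_gt; [lia|]; now apply substs_everywhere.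
  - intros v l o args args' IH; simpl.
    apply subst_op, substs_pointwise.
    eapply pointwise_zipw; [|apply IH].
    intros b x x' H; simpl in H.
    replace (fst b + (v + S v0)) with (v + fst b + S v0) by lia.
    replace (snd b + (l + l0)) with (l + snd b + l0) by lia.
    now replace (fst b + (v + v0)) with (v + fst b + v0) by lia.
Qed.

Lemma lock_unit_ren v0 l0 v l a a' :
  lock_unit v l a a' ->
  lock_unit v l (θ (v + S v0) (l + S l0) a) (θ (v + v0) (l + l0) a').
Proof.
  revert v l a a'; apply lock_unit_nested_ind.
  - intros v l n ks ks' Hn IH.
    rewrite !ren_bound by lia.
    apply lock_unit_lt; auto; now apply lock_units_everywhere, Forall2_map_both.
  - intros v l t t' ks Hl IH.
    rewrite !ren_bound by lia; simpl.
    apply lock_unit_eq; auto; now rewrite length_map.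
  - intros v l n js js' t ks ks' Hn Hl IHj IHk.
    assert (Lj := Forall2_length IHj); assert (Lk := Forall2_length IHk).
    destruct (Nat.ltb_spec n (v + v0)) as [Hb|Hb].
    + rewrite !ren_bound by lia; rewrite !map_app; simpl.
      apply lock_unit_gt; auto; try (now rewrite length_map);
        now apply lock_units_everywhere, Forall2_map_both.
    + destruct (split_at_end _ l0 js) as (j1 & j2 & -> & E).
      destruct (Forall2_app_inv_l _ _ IHj) as (j1' & j2' & H1 & H2 & ->).
      assert (L1 := Forall2_length H1); assert (L2 := Forall2_length H2).
      rewrite <- !app_assoc.
      rewrite !ren_free by (rewrite ?length_app in *; simpl; lia).
      apply Forall2_map_both in H1, H2, IHk.
      set (f := θ (v + S v0) (l + S l0)) in *; set (g := θ (v + v0) (l + l0)) in *.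
      rewrite !map_app; simpl.
      assert (Hlk : length (map f ks) = l) by now rewrite length_map.
      rewrite (app_assoc _ (map f j2) (f t :: _)).
      rewrite (app_assoc (map f j1) _ (f t :: _)).
      rewrite (app_assoc _ (map g j2') (map g ks')).
      rewrite (app_assoc (map g j1') _ (map g ks')).
      apply lock_unit_gt; auto; try lia;
        apply lock_units_everywhere; auto.
      repeat apply Forall2_app; auto.
      apply Forall2_map_both.
      apply Forall2_diagonal; intros p.
      replace (p + (v + S v0)) with (S (p + (v + v0))) by lia.
      apply lock_unit_gt; auto; try lia; now apply lock_units_everywhere.
  - intros v l o args args' IH; simpl.
    apply lock_unit_op, lock_units_pointwise.
    eapply pointwise_zipw; [|apply IH].
    intros b x x' H; simpl in H.
    replace (fst b + (v + S v0)) with (v + fst b + S v0) by lia.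
    replace (snd b + (l + S l0)) with (l + snd b + S l0) by lia.
    replace (snd b + (l + l0)) with (l + snd b + l0) by lia.
    now replace (fst b + (v + v0)) with (v + fst b + v0) by lia.
Qed.
End counit_ren.

Lemma ren_no_keys w v l a : ren w [] v l a = shift w v a.
Proof.
  revert v l; induction a as [n ts IH|o args IH] using tm_nested_ind; intros v l; simpl.
  - assert (E : map (ren w [] v l) ts = map (shift w v) ts).
    { apply map_ext_Forall; eapply Forall_impl; [|apply IH]; simpl; auto. }
    rewrite E, firstn_skipn; now destruct (n <? v).
  - f_equal; apply zipw_ext; intros b; eapply Forall_impl; [|apply IH].
    intros a Ha; rewrite Ha; f_equal; lia.
Qed.

(** The bound on [c] places the weakening within the block of inserted variables or at its left end.
    Every old free variable lies beyond it and moves; a key variable moves only if its index is at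
    least [c]. *)
Lemma shift_ren_inside c k w ps a v l :
  c <= w ->
  shift k (v + c) (ren w ps v l a) =
  ren (w + k) (map (fun p => if p <? c then p else p + k) ps) v l a.
Proof.
  intros Hc; revert v l; induction a as [n ts IH|o args IH] using tm_nested_ind;
    intros v l.
  - assert (Hm : forall us, Forall (fun a => forall v l, shift k (v + c) (ren w ps v l a) =
        ren (w + k) (map (fun p => if p <? c then p else p + k) ps) v l a) us ->
      map (shift k (v + c)) (map (ren w ps v l) us) =
      map (ren (w + k) (map (fun p => if p <? c then p else p + k) ps) v l) us).
    { intros us H; rewrite map_map; apply map_ext_Forall.
      eapply Forall_impl; [|apply H]; simpl; auto. }
    destruct (Nat.ltb_spec n v) as [Hn|Hn].
    + rewrite !ren_bound by auto; simpl.
      destruct (Nat.ltb_spec n (v + c)); [|lia]; f_equal; auto.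
    + destruct (split_at_end _ l ts) as (js & ks & -> & E).
      apply Forall_app in IH as [IHj IHk]; apply Hm in IHj, IHk.
      rewrite !ren_free by auto; simpl.
      destruct (Nat.ltb_spec (n + w) (v + c)); [lia|].
      f_equal; [lia|].
      rewrite !map_app, IHj, IHk; f_equal; f_equal.
      rewrite !(map_map _ _ ps); apply map_ext; intros p; simpl.
      rewrite IHk.
      destruct (Nat.ltb_spec (p + v) (v + c)), (Nat.ltb_spec p c); try lia;
        f_equal; lia.
  - simpl; f_equal.
    change (zipw (fun b => shift k (v + c + fst b))
      (zipw (fun b => ren w ps (fst b + v) (snd b + l)) args (arity o)) (arity o) =
      zipw (fun b => ren (w + k) (map (fun p => if p <? c then p else p + k) ps)
        (fst b + v) (snd b + l)) args (arity o)).
    rewrite zipw_zipw; apply zipw_ext; intros b.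
    eapply Forall_impl; [|apply IH]; intros a Ha; simpl.
    rewrite <- Ha; f_equal; lia.
Qed.

(** * Scoping *)

(** [d n] is the number of locks to the right of the variable [n]. *)
Definition lift (v l : nat) (d : nat -> nat) (n : nat) : nat :=
  if n <? v then l else d (n - v) + l.

(** The part of well-typedness on which the operations depend. The function [d] stands for the
    context, and no bound on indices is imposed. *)
Inductive scoped : (nat -> nat) -> tm -> Prop :=
| scoped_Var d n ts :
    length ts = d n -> Forall (scoped d) ts -> scoped d (Var n ts)
| scoped_Op d o args :
    Forall2 (fun b t => scoped (lift (fst b) (snd b) d) t) (arity o) args ->
    scoped d (Op o args).

Lemma scoped_Var_iff d n ts :
  scoped d (Var n ts) <-> length ts = d n /\ Forall (scoped d) ts.
Proof. split; [intros H; now inversion H | intros []; now constructor]. Qed.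

Lemma scoped_Op_iff d o args :
  scoped d (Op o args) <->
  Forall2 (fun b t => scoped (lift (fst b) (snd b) d) t) (arity o) args.
Proof. split; [intros H; now inversion H | now constructor]. Qed.

(** [inserted w m v l d d' du]: to the left of the last [v] variables and [l]
    locks of [d], [d'] has [w] variables and [m] locks more than [d]; [du] is
    [d'] without the last [v] variables and [l] locks. *)
Definition inserted (w m v l : nat) (d d' du : nat -> nat) : Prop :=
  (forall n, v <= n -> l <= d n) /\
  (forall n, v <= n -> d' (n + w) = d n + m) /\
  (forall n, n < v -> d' n = d n) /\
  (forall n, d' (n + v) = du n + l).

Ltac lift_cases :=
  unfold lift; repeat match goal with
  | |- context [?n <? ?v] => destruct (Nat.ltb_spec n v)
  end.

Lemma inserted_under w m v l d d' du b c :
  inserted w m v l d d' du ->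
  inserted w m (v + b) (l + c) (lift b c d) (lift b c d') du.
Proof.
  intros (H1 & H2 & H3 & H4); repeat split; intros n.
  - intros H; lift_cases; try lia; specialize (H1 (n - b)); lia.
  - intros H; lift_cases; try lia.
    replace (n + w - b) with (n - b + w) by lia; rewrite H2; lia.
  - intros H; lift_cases; try lia; rewrite H3; lia.
  - lift_cases; try lia.
    replace (n + (v + b) - b) with (n + v) by lia; rewrite H4; lia.
Qed.

(** Even at the right end of the context the clause for free variables subjects the inserted keys to
    one more counit, which then inserts nothing. Scoping provides the [l] keys which that clause
    splits off. *)
Lemma lock_counit_identity d v l a :
  scoped d a -> (forall n, v <= n -> l <= d n) -> lock_counit 0 [] v l a a.
Proof.
  revert d v l; induction a as [n ts IH|o args IH] using tm_nested_ind;
    intros d v l Ha Hl.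
  - apply scoped_Var_iff in Ha as [Hlen Ha].
    assert (Hts : Forall2 (lock_counit 0 [] v l) ts ts).
    { clear - IH Ha Hl; induction ts; inversion IH; inversion Ha; subst; eauto. }
    destruct (Nat.ltb_spec n v) as [Hn|Hn].
    + apply lock_counit_bound; auto; now apply lock_counits_everywhere.
    + specialize (Hl n Hn); rewrite <- Hlen in Hl.
      destruct (split_at_end_length _ l ts Hl) as (js & ks & -> & E).
      destruct (Forall2_app_inv_l _ _ Hts) as (js' & ks' & Hj & Hk & Es).
      apply app_eq_app_length in Es as [<- <-]; [|apply (Forall2_length Hj)].
      replace (Var n (js ++ ks)) with (Var (n + 0) (js ++ [] ++ ks)) at 2
        by now rewrite Nat.add_0_r.
      apply lock_counit_free; rewrite ?lock_counits_everywhere; auto.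
  - apply scoped_Op_iff in Ha.
    apply lock_counit_op, lock_counits_pointwise; unfold under.
    induction Ha as [|b t bs args Ht _ IHa]; [constructor|].
    inversion IH; subst; constructor; auto.
    eapply H1; eauto.
    intros n Hn; lift_cases; try lia; specialize (Hl (n - fst b)); lia.
Qed.

Lemma lock_counits_identity d ks :
  Forall (scoped d) ks -> lock_counits 0 [] (everywhere 0 0 ks) ks ks.
Proof.
  induction 1; constructor; auto.
  eapply lock_counit_identity; eauto; lia.
Qed.

Lemma scoped_lock_counit w us v l a a' :
  lock_counit w us v l a a' ->
  forall d d' du, inserted w (length us) v l d d' du ->
  Forall (scoped du) us -> scoped d a -> scoped d' a'.
Proof.
  revert w us v l a a'; apply (lock_counit_nested_ind (fun w us v l a a' =>
    forall d d' du, inserted w (length us) v l d d' du ->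
    Forall (scoped du) us -> scoped d a -> scoped d' a')).
  - intros w us v l n ks ks' Hn IH d d' du Hd Hu Ha.
    apply scoped_Var_iff in Ha as [Hlen Ha].
    constructor.
    + rewrite <- (Forall2_length IH), Hlen; symmetry; now apply Hd.
    + clear - IH Ha Hd Hu; induction IH; inversion Ha; subst; eauto.
  - intros w us v l n js js' ks ks' us' Hn Hl IHj IHk _ IHu _ d d' du Hd Hu Ha.
    apply scoped_Var_iff in Ha as [Hlen Ha].
    apply Forall_app in Ha as [Hj Hk].
    assert (Hk' : Forall (scoped d') ks').
    { clear - IHk Hk Hd Hu; induction IHk; inversion Hk; subst; eauto. }
    assert (Hj' : Forall (scoped d') js').
    { clear - IHj Hj Hd Hu; induction IHj; inversion Hj; subst; eauto. }
    assert (Lj := Forall2_length IHj); assert (Lk := Forall2_length IHk).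
    assert (Lu := Forall2_length IHu).
    constructor.
    + destruct Hd as (_ & -> & _); auto; rewrite !length_app in *; lia.
    + repeat (apply Forall_app; split); auto.
      (* The inner counit moves the keys from G, G' to G, G', G'': it inserts all of G'' at the
         right end. *)
      assert (Hi : inserted v (length ks') 0 0 du d' d').
      { repeat split; intros; try lia; rewrite ?Nat.add_0_r; auto.
        destruct Hd as (_ & _ & _ & ->); lia. }
      clear - IHu Hu Hi Hk'; induction IHu; inversion Hu; subst; eauto.
  - intros w us v l o args args' IH d d' du Hd Hu Ha.
    apply scoped_Op_iff in Ha; apply scoped_Op_iff; unfold under in IH.
    revert args' IH; induction Ha as [|b t bs args Ht _ IHa]; intros args' IH;
      inversion IH as [|? ? ? ? ? ? ? HR]; subst; constructor; auto.
    eapply HR; [apply inserted_under, Hd | exact Hu | exact Ht].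
Qed.

(** Scoping guarantees at least [l] keys at each free variable, as the clause of the counit demands;
    [du p = 0] makes [var p] a scoped key. *)
Lemma ren_graph w ps v l a d d' du :
  inserted w (length ps) v l d d' du ->
  Forall (fun p => du p = 0) ps -> scoped d a ->
  lock_counit w (map (fun p => var p) ps) v l a (ren w ps v l a).
Proof.
  revert v l d d'; induction a as [n ts IH|o args IH] using tm_nested_ind;
    intros v l d d' Hd Hp Ha.
  - apply scoped_Var_iff in Ha as [Hlen Ha].
    assert (Hts : Forall2 (lock_counit w (map (fun p => var p) ps) v l) ts
                    (map (ren w ps v l) ts)).
    { clear - IH Hd Hp Ha; induction ts; inversion IH; inversion Ha; subst;
        simpl; constructor; eauto. }
    destruct (Nat.ltb_spec n v) as [Hn|Hn].
    + rewrite ren_bound by auto.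
      apply lock_counit_bound; auto; now apply lock_counits_everywhere.
    + assert (Hl : l <= length ts) by (rewrite Hlen; now apply Hd).
      destruct (split_at_end_length _ l ts Hl) as (js & ks & -> & E).
      rewrite map_app in Hts.
      destruct (Forall2_app_inv_l _ _ Hts) as (js' & ks' & Hj & Hk & Es).
      apply app_eq_app_length in Es as [<- <-];
        [|now rewrite length_map, <- (Forall2_length Hj)].
      rewrite ren_free by (rewrite ?length_app; lia).
      apply lock_counit_free; rewrite ?lock_counits_everywhere; auto.
      apply Forall2_map_both, Forall2_diagonal; intros p.
      replace (Var (p + v) (map (ren w ps v l) ks))
        with (Var (p + v) ([] ++ map (ren w ps v l) ks ++ []))
        by now rewrite app_nil_r.
      apply (lock_counit_free v (map (ren w ps v l) ks) 0 0 p [] [] [] []);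
        try apply lock_counits_everywhere; auto; try lia.
      apply lock_counits_everywhere.
      assert (Hsc : Forall (scoped d') (map (ren w ps v l) ks)).
      { apply Forall_app in Ha as [_ Ha].
        assert (Hu : Forall (scoped du) (map (fun p => var p) ps)).
        { apply Forall_map; eapply Forall_impl; [|apply Hp].
          intros q Hq; now constructor. }
        clear - Hk Ha Hu Hd; induction ks; inversion Hk; inversion Ha; subst;
          constructor; auto.
        eapply scoped_lock_counit; eauto; now rewrite length_map. }
      eapply lock_counits_identity; eauto.
  - apply scoped_Op_iff in Ha; simpl.
    apply lock_counit_op, lock_counits_pointwise; unfold under.
    induction Ha as [|b t bs args Ht _ IHa]; [constructor|].
    inversion IH; subst; constructor; auto.
    rewrite (Nat.add_comm (fst b)), (Nat.add_comm (snd b)).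
    eapply H1; [apply inserted_under, Hd | exact Hp | exact Ht].
Qed.

Lemma ren_graph_top w ps a d :
  scoped d a -> Forall (fun p => p < w) ps ->
  lock_counit w (map (fun p => var p) ps) 0 0 a (ren w ps 0 0 a).
Proof.
  intros Ha Hp.
  (* For the graph any placement of the new locks will do. Here they all stand to the left of the
     [w] new variables, so that each of these can serve as a key. *)
  set (d' := fun n => if n <? w then 0 else d (n - w) + length ps).
  apply ren_graph with (d := d) (d' := d') (du := d'); auto.
  - repeat split; intros n; rewrite ?Nat.add_0_r; try lia.
    intros _; unfold d'; destruct (Nat.ltb_spec (n + w) w); try lia.
    now rewrite Nat.add_sub.
  - eapply Forall_impl; [|apply Hp]; intros p H; unfold d'.
    now apply Nat.ltb_lt in H as ->.
Qed.

Lemma scoped_ren w ps v l a d d' du :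
  inserted w (length ps) v l d d' du ->
  Forall (fun p => du p = 0) ps -> scoped d a -> scoped d' (ren w ps v l a).
Proof.
  intros Hd Hp Ha.
  eapply scoped_lock_counit; [eapply ren_graph; eauto | | | exact Ha].
  - rewrite length_map; exact Hd.
  - apply Forall_map; eapply Forall_impl; [|apply Hp].
    intros q Hq; now constructor.
Qed.

(** Here the renaming acts inside the part of the context that the counit
    inserts, and is therefore absorbed by the keys of the counit. *)
Lemma lock_counit_ren_inside W ps w us v l a a' :
  lock_counit w us v l a a' ->
  forall v0 l0 us1 us2 d d' du d2 du2,
  v0 <= w -> us = us1 ++ us2 -> length us2 = l0 ->
  inserted w (length us) v l d d' du ->
  inserted W (length ps) (v + v0) (l + l0) d' d2 du2 ->
  Forall (fun p => du2 p = 0) ps -> Forall (scoped du) us -> scoped d a ->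
  let θ := ren W ps v0 l0 in
  lock_counit (w + W)
    (map θ us1 ++ map (fun p => Var (p + v0) (map θ us2)) ps ++ map θ us2)
    v l a (ren W ps (v + v0) (l + l0) a').
Proof.
  revert w us v l a a'; apply (lock_counit_nested_ind (fun w us v l a a' =>
    forall v0 l0 us1 us2 d d' du d2 du2,
    v0 <= w -> us = us1 ++ us2 -> length us2 = l0 ->
    inserted w (length us) v l d d' du ->
    inserted W (length ps) (v + v0) (l + l0) d' d2 du2 ->
    Forall (fun p => du2 p = 0) ps -> Forall (scoped du) us -> scoped d a ->
    let θ := ren W ps v0 l0 in
    lock_counit (w + W)
      (map θ us1 ++ map (fun p => Var (p + v0) (map θ us2)) ps ++ map θ us2)
      v l a (ren W ps (v + v0) (l + l0) a'))).
  - intros w us v l n ks ks' Hn IH v0 l0 us1 us2 d d' du d2 du2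
      Hw Eu El Hd Hd2 Hp Hu Ha θ.
    apply scoped_Var_iff in Ha as [_ Ha].
    rewrite ren_bound by lia.
    apply lock_counit_bound; auto; apply lock_counits_everywhere.
    clear - IH Hw Eu El Hd Hd2 Hp Hu Ha.
    induction IH; inversion Ha; subst; simpl; constructor; auto.
    eapply H; eauto.
  - intros w us v l n js js' ks ks' us' Hn Hl IHj IHk Hks _ Hus
      v0 l0 us1 us2 d d' du d2 du2 Hw Eu El Hd Hd2 Hp Hu Ha θ.
    apply scoped_Var_iff in Ha as [_ Ha].
    apply Forall_app in Ha as [Hj Hk].
    set (US := map θ us1 ++ map (fun p => Var (p + v0) (map θ us2)) ps ++ map θ us2).
    set (g := ren W ps (v + v0) (l + l0)).
    assert (Hk' : Forall2 (lock_counit (w + W) US v l) ks (map g ks')).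
    { clear - IHk Hw Eu El Hd Hd2 Hp Hu Hk.
      induction IHk; inversion Hk; subst; simpl; constructor; auto.
      eapply H; eauto. }
    assert (Hj' : Forall2 (lock_counit (w + W) US v l) js (map g js')).
    { clear - IHj Hw Eu El Hd Hd2 Hp Hu Hj.
      induction IHj; inversion Hj; subst; simpl; constructor; auto.
      eapply H; eauto. }
    assert (Lk := Forall2_length Hks); assert (Lj := Forall2_length IHj).
    subst us; destruct (Forall2_app_inv_l _ _ Hus) as (us1' & us2' & H1 & H2 & ->).
    assert (L1 := Forall2_length H1); assert (L2 := Forall2_length H2).
    assert (Hθ : forall us us', Forall2 (lock_counit v ks' 0 0) us us' ->
      Forall2 (lock_counit v (map g ks') 0 0) (map θ us) (map g us')).
    { intros us us' H; apply Forall2_map_both; eapply Forall2_impl; [|apply H].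
      intros u u' Huu; apply (lock_counit_ren W ps) with (v0 := v0) (l0 := l0) in Huu.
      rewrite <- Lk, Hl in Huu; exact Huu. }
    assert (Hsc : Forall (scoped d2) (map g ks')).
    { clear - Hks Hk Hd Hd2 Hp Hu.
      induction Hks; inversion Hk; subst; simpl; constructor; auto.
      eapply scoped_ren; eauto; eapply scoped_lock_counit; eauto. }
    (* The last [l + l0] keys are [us2' ++ ks'], so [ren] inserts its keys between [us1'] and
       [us2'], which is where the enlarged key list of the counit has them. *)
    replace (js' ++ (us1' ++ us2') ++ ks') with ((js' ++ us1') ++ (us2' ++ ks'))
      by now rewrite <- !app_assoc.
    unfold g at 1; rewrite ren_free by (rewrite ?length_app; lia).
    fold g; rewrite !map_app.
    replace (n + w + W) with (n + (w + W)) by lia.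
    set (P := map (fun p => Var (p + (v + v0)) (map g us2' ++ map g ks')) ps).
    replace ((map g js' ++ map g us1') ++ P ++ map g us2' ++ map g ks')
      with (map g js' ++ (map g us1' ++ P ++ map g us2') ++ map g ks')
      by now rewrite <- !app_assoc.
    apply lock_counit_free; rewrite ?lock_counits_everywhere; auto.
    repeat apply Forall2_app; auto.
    apply Forall2_map_both, Forall2_diagonal; intros p.
    replace (p + (v + v0)) with (p + v0 + v) by lia.
    (* This inner counit acts at the right end of the context, so no keys follow its place of
       insertion. *)
    rewrite <- (app_nil_r (map θ us2)).
    replace (map g us2' ++ map g ks') with (map g us2' ++ map g ks' ++ [])
      by now rewrite app_nil_r.
    apply lock_counit_free; rewrite ?lock_counits_everywhere; auto; try lia.
    eapply lock_counits_everywhere, lock_counits_identity; eauto.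
  - intros w us v l o args args' IH v0 l0 us1 us2 d d' du d2 du2
      Hw Eu El Hd Hd2 Hp Hu Ha θ.
    apply scoped_Op_iff in Ha; simpl.
    apply lock_counit_op, lock_counits_pointwise; unfold under in *.
    revert args' IH; induction Ha as [|b t bs args Ht _ IHa]; intros args' IH;
      inversion IH as [|? ? ? ? ? ? ? HR]; subst; simpl; constructor; auto.
    replace (fst b + (v + v0)) with (v + fst b + v0) by lia.
    replace (snd b + (l + length us2)) with (l + snd b + length us2) by lia.
    eapply HR; try reflexivity; eauto.
    + apply inserted_under; eauto.
    + replace (v + fst b + v0) with (v + v0 + fst b) by lia.
      replace (l + snd b + length us2) with (l + length us2 + snd b) by lia.
      apply inserted_under; eauto.
Qed.

(** The counterpart of [inserted] for substitution: [d], [d'] and [da] count the locks in G, x:A, G'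
    and in G, G' and in G. *)
Definition substituted (v l : nat) (d d' da : nat -> nat) : Prop :=
  (forall n, n < v -> d n = d' n) /\ d v = l /\
  (forall n, v <= n -> d (S n) = d' n) /\ (forall n, d' (n + v) = da n + l).

Lemma substituted_under v l d d' da b c :
  substituted v l d d' da ->
  substituted (v + b) (l + c) (lift b c d) (lift b c d') da.
Proof.
  intros (H1 & H2 & H3 & H4); repeat split.
  - intros n H; lift_cases; try lia; rewrite H1; lia.
  - lift_cases; try lia; now rewrite Nat.add_sub, H2.
  - intros n H; lift_cases; try lia.
    replace (S n - b) with (S (n - b)) by lia; rewrite H3; lia.
  - intros n; lift_cases; try lia.
    replace (n + (v + b) - b) with (n + v) by lia; rewrite H4; lia.
Qed.

Lemma scoped_subst a v l b b' :
  subst a v l b b' ->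
  forall d d' da, substituted v l d d' da ->
  scoped da a -> scoped d b -> scoped d' b'.
Proof.
  revert v l b b'; apply (subst_nested_ind a (fun v l b b' =>
    forall d d' da, substituted v l d d' da ->
    scoped da a -> scoped d b -> scoped d' b')).
  - intros v l n ks ks' Hn IH d d' da Hd Ha Hb.
    apply scoped_Var_iff in Hb as [Hlen Hb]; constructor.
    + rewrite <- (Forall2_length IH), Hlen; now apply Hd.
    + clear - IH Hd Ha Hb; induction IH; inversion Hb; subst; eauto.
  - intros v l ks ks' a' Hl IH Hc d d' da Hd Ha Hb.
    apply scoped_Var_iff in Hb as [Hlen Hb].
    assert (Lk := Forall2_length IH).
    eapply scoped_lock_counit with (du := d'); [exact Hc| |  |exact Ha].
    + destruct Hd as (_ & _ & _ & Hd).
      repeat split; intros; try lia; rewrite ?Nat.add_0_r; auto.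
      rewrite Hd; lia.
    + clear - IH Hd Ha Hb; induction IH; inversion Hb; subst; eauto.
  - intros v l n ks ks' Hn IH d d' da Hd Ha Hb.
    apply scoped_Var_iff in Hb as [Hlen Hb]; constructor.
    + rewrite <- (Forall2_length IH), Hlen; now apply Hd.
    + clear - IH Hd Ha Hb; induction IH; inversion Hb; subst; eauto.
  - intros v l o args args' IH d d' da Hd Ha Hb.
    apply scoped_Op_iff in Hb; apply scoped_Op_iff; unfold under in IH.
    revert args' IH; induction Hb as [|b t bs args Ht _ IHb]; intros args' IH;
      inversion IH as [|? ? ? ? ? ? ? HR]; subst; constructor; auto.
    eapply HR; [apply substituted_under, Hd | exact Ha | exact Ht].
Qed.

(** The removed variable has index [v], and the removed lock stood to the right of every variable of
    G, each of which therefore loses one lock. *)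
Definition unit_applied (v l : nat) (d d' : nat -> nat) : Prop :=
  (forall n, n < v -> d n = d' n) /\ (forall n, v <= n -> d (S n) = S (d' n)).

Lemma unit_applied_under v l d d' b c :
  unit_applied v l d d' -> unit_applied (v + b) (l + c) (lift b c d) (lift b c d').
Proof.
  intros (H1 & H2); split; intros n H; lift_cases; try lia.
  - rewrite H1; lia.
  - replace (S n - b) with (S (n - b)) by lia; rewrite H2; lia.
Qed.

Lemma scoped_lock_unit v l a a' :
  lock_unit v l a a' ->
  forall d d', unit_applied v l d d' -> scoped d a -> scoped d' a'.
Proof.
  revert v l a a'; apply (lock_unit_nested_ind (fun v l a a' =>
    forall d d', unit_applied v l d d' -> scoped d a -> scoped d' a')).
  - intros v l n ks ks' Hn IH d d' Hd Ha.
    apply scoped_Var_iff in Ha as [Hlen Ha]; constructor.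
    + rewrite <- (Forall2_length IH), Hlen; now apply Hd.
    + clear - IH Hd Ha; induction IH; inversion Ha; subst; eauto.
  - intros v l t t' ks Hl IH d d' Hd Ha.
    apply scoped_Var_iff in Ha as [Hlen Ha]; inversion Ha; subst; eauto.
  - intros v l n js js' t ks ks' Hn Hl IHj IHk d d' Hd Ha.
    apply scoped_Var_iff in Ha as [Hlen Ha].
    apply Forall_app in Ha as [Hj Hk]; apply Forall_inv_tail in Hk as Hk'.
    constructor.
    + destruct Hd as [_ Hd]; rewrite Hd in Hlen by auto.
      rewrite length_app in *; simpl in Hlen.
      rewrite <- (Forall2_length IHj), <- (Forall2_length IHk); lia.
    + apply Forall_app; split.
      * clear - IHj Hd Hj; induction IHj; inversion Hj; subst; eauto.
      * clear - IHk Hd Hk'; induction IHk; inversion Hk'; subst; eauto.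
  - intros v l o args args' IH d d' Hd Ha.
    apply scoped_Op_iff in Ha; apply scoped_Op_iff; unfold under in IH.
    revert args' IH; induction Ha as [|b t bs args Ht _ IHa]; intros args' IH;
      inversion IH as [|? ? ? ? ? ? ? HR]; subst; constructor; auto.
    eapply HR; [apply unit_applied_under, Hd | exact Ht].
Qed.

(** The variable substituted for does not occur: old free variables have moved past it since
    [v0 <= w], and key variables lie to its right. *)
Lemma subst_ren_cancel_under b v0 l0 w ps a v l d :
  v0 <= w -> Forall (fun p => p < v0) ps -> scoped d a ->
  subst b (v + v0) (l + l0) (ren (S w) ps v l a) (ren w ps v l a).
Proof.
  intros Hw Hp; revert v l d; induction a as [n ts IH|o args IH] using tm_nested_ind;
    intros v l d Ha.
  - apply scoped_Var_iff in Ha as [_ Ha].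
    assert (Hts : Forall2 (subst b (v + v0) (l + l0)) (map (ren (S w) ps v l) ts)
                    (map (ren w ps v l) ts)).
    { clear - IH Ha; induction ts; inversion IH; inversion Ha; subst;
        simpl; constructor; eauto. }
    destruct (Nat.ltb_spec n v) as [Hn|Hn].
    + rewrite !ren_bound by auto.
      apply subst_lt; [lia|]; now apply substs_everywhere.
    + destruct (split_at_end _ l ts) as (js & ks & -> & E).
      rewrite !ren_free by auto; rewrite !map_app in Hts.
      destruct (Forall2_app_inv_l _ _ Hts) as (js' & ks' & Hj & Hk & Es).
      apply app_eq_app_length in Es as [<- <-];
        [|now rewrite length_map, <- (Forall2_length Hj), length_map].
      rewrite <- plus_n_Sm.
      apply subst_gt; [lia|]; apply substs_everywhere.
      repeat apply Forall2_app; auto.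
      apply Forall2_map_both.
      set (f := map (ren (S w) ps v l) ks) in *; set (g := map (ren w ps v l) ks) in *.
      clearbody f g; clear - Hp Hk; induction Hp; constructor; auto.
      apply subst_lt; [lia|]; now apply substs_everywhere.
  - apply scoped_Op_iff in Ha; simpl.
    apply subst_op, substs_pointwise; unfold under.
    induction Ha as [|c t bs args Ht _ IHa]; [constructor|].
    inversion IH as [|? ? HR]; subst; constructor; auto.
    replace (v + v0 + fst c) with (fst c + v + v0) by lia.
    replace (l + l0 + snd c) with (snd c + l + l0) by lia.
    eapply HR; exact Ht.
Qed.

Lemma subst_ren_cancel b v l w ps a d :
  scoped d a -> v <= w -> Forall (fun p => p < v) ps ->
  subst b v l (ren (S w) ps 0 0 a) (ren w ps 0 0 a).
Proof. intros Ha Hw Hp; exact (subst_ren_cancel_under b v l w ps a 0 0 d Hw Hp Ha). Qed.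

(** * Preservation of typing *)

(** The depth function [d] of a context. An index out of range counts all locks, which keeps the
    identities for concatenated contexts free of upper bounds on the index. *)
Fixpoint locks_after (G : ctx) (n : nat) : nat :=
  match G with
  | [] => 0
  | cvar _ :: G => match n with 0 => 0 | S n => locks_after G n end
  | clock :: G => S (locks_after G n)
  end.

Lemma scoped_ext d d' a : (forall n, d n = d' n) -> scoped d a -> scoped d' a.
Proof.
  revert d d'; induction a as [n ts IH|o args IH] using tm_nested_ind;
    intros d d' Hd Ha.
  - apply scoped_Var_iff in Ha as [Hlen Ha]; constructor; [now rewrite <- Hd|].
    clear Hlen; induction Ha; inversion IH; subst; constructor; eauto.
  - apply scoped_Op_iff in Ha; constructor.
    induction Ha; inversion IH; subst; constructor; eauto.
    eapply H2; [|exact H]; intros n; lift_cases; now rewrite ?Hd.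
Qed.

Lemma nvars_app G1 G2 : nvars (G1 ++ G2) = nvars G1 + nvars G2.
Proof. induction G1 as [|[A|] G1 IH]; simpl; lia. Qed.

Lemma nlocks_app G1 G2 : nlocks (G1 ++ G2) = nlocks G1 + nlocks G2.
Proof. induction G1 as [|[A|] G1 IH]; simpl; lia. Qed.

Lemma locks_after_app_lt G1 G2 n :
  n < nvars G1 -> locks_after (G1 ++ G2) n = locks_after G1 n.
Proof.
  revert n; induction G1 as [|[A|] G1 IH]; simpl; intros n H; [lia| |auto].
  destruct n; auto; apply IH; lia.
Qed.

Lemma locks_after_app_ge G1 G2 n :
  locks_after (G1 ++ G2) (n + nvars G1) = locks_after G2 n + nlocks G1.
Proof.
  induction G1 as [|[A|] G1 IH]; simpl; rewrite ?Nat.add_0_r; auto.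
  - now rewrite <- plus_n_Sm.
  - rewrite IH; lia.
Qed.

Lemma locks_after_var G1 A G2 :
  locks_after (G1 ++ cvar A :: G2) (nvars G1) = nlocks G1.
Proof. exact (locks_after_app_ge G1 (cvar A :: G2) 0). Qed.

Lemma inserted_ctx G1 G2 G :
  inserted (nvars G2) (nlocks G2) (nvars G1) (nlocks G1)
    (locks_after (G1 ++ G)) (locks_after (G1 ++ G2 ++ G)) (locks_after (G2 ++ G)).
Proof.
  assert (E : forall G0 n, nvars G1 <= n ->
    locks_after (G1 ++ G0) n = locks_after G0 (n - nvars G1) + nlocks G1).
  { intros G0 n H; rewrite <- locks_after_app_ge; f_equal; lia. }
  repeat split; intros n.
  - intros H; rewrite E; lia.
  - intros H; rewrite !E by lia.
    replace (n + nvars G2 - nvars G1) with (n - nvars G1 + nvars G2) by lia.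
    rewrite locks_after_app_ge; lia.
  - intros H; now rewrite !locks_after_app_lt.
  - apply locks_after_app_ge.
Qed.

Scheme has_type_keys_ind := Minimality for has_type Sort Prop
  with keys_has_type_ind := Minimality for keys Sort Prop.

Lemma scoped_lift00 G a :
  scoped (locks_after G) a -> scoped (lift 0 0 (locks_after G)) a.
Proof.
  apply scoped_ext; intros n; lift_cases; rewrite ?Nat.sub_0_r; lia.
Qed.

Lemma scoped_lift10 G A a :
  scoped (locks_after (cvar A :: G)) a -> scoped (lift 1 0 (locks_after G)) a.
Proof.
  apply scoped_ext; intros [|n]; lift_cases; simpl; rewrite ?Nat.sub_0_r; lia.
Qed.

Lemma scoped_lift20 G A B a :
  scoped (locks_after (cvar B :: cvar A :: G)) a ->
  scoped (lift 2 0 (locks_after G)) a.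
Proof.
  apply scoped_ext; intros [|[|n]]; lift_cases; simpl; rewrite ?Nat.sub_0_r; lia.
Qed.

Lemma scoped_lift01 G a :
  scoped (locks_after (clock :: G)) a -> scoped (lift 0 1 (locks_after G)) a.
Proof.
  apply scoped_ext; intros n; lift_cases; simpl; rewrite ?Nat.sub_0_r; lia.
Qed.

Create HintDb scoping.
#[local] Hint Resolve scoped_lift00 scoped_lift10 scoped_lift20 scoped_lift01 : scoping.

Ltac scoped_op :=
  apply scoped_Op_iff; cbn [arity];
  repeat apply Forall2_cons; try apply Forall2_nil; cbn [fst snd]; eauto with scoping.

Lemma typed_scoped G a A : G ⊢ a ∈ A -> scoped (locks_after G) a.
Proof.
  revert G a A.
  apply (has_type_keys_ind (fun G a _ => scoped (locks_after G) a)
           (fun G ts => Forall (scoped (locks_after G)) ts));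
    intros; auto; try (scoped_op; fail).
  constructor; auto; now rewrite locks_after_var.
Qed.

Lemma keys_scoped G ts : keys G ts -> Forall (scoped (locks_after G)) ts.
Proof. induction 1; constructor; eauto using typed_scoped. Qed.

Lemma scoped_wk G A a :
  scoped (locks_after G) a -> scoped (locks_after (cvar A :: G)) (wk 1 a).
Proof.
  intros Ha; rewrite <- (ren_no_keys 1 0 0 a).
  apply (scoped_ren 1 [] 0 0 a _ _ _ (inserted_ctx [] [cvar A] G)); auto.
Qed.

Lemma substituted_ctx G A :
  substituted 0 0 (locks_after (cvar A :: G)) (locks_after G) (locks_after G).
Proof. repeat split; intros; simpl; rewrite ?Nat.add_0_r; lia. Qed.

Scheme eq_tm_keys_eq_ind := Minimality for eq_tm Sort Prop
  with keys_eq_eq_tm_ind := Minimality for keys_eq Sort Prop.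

(** In the congruence rule for variables the keys are known only through an equation, yet renaming
    the counit in its type requires them to be scoped. *)
Lemma eq_scoped G a b A :
  G ⊢ a ≡ b ∈ A -> scoped (locks_after G) a /\ scoped (locks_after G) b.
Proof.
  revert G a b A.
  apply (eq_tm_keys_eq_ind
    (fun G a b _ => scoped (locks_after G) a /\ scoped (locks_after G) b)
    (fun G ts us => Forall (scoped (locks_after G)) ts /\
       Forall (scoped (locks_after G)) us /\ length ts = length us));
    intros; repeat match goal with H : _ /\ _ |- _ => destruct H end;
    repeat match goal with
    | H : _ ⊢ ?a ∈ _ |- _ =>
        match goal with
        | H' : scoped _ a |- _ => fail 1
        | _ => let H' := fresh in assert (H' := typed_scoped _ _ _ H)
        end
    end;
    try (split; auto; scoped_op; fail);
    try (repeat split; simpl; auto; fail).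
  - split; constructor; rewrite ?locks_after_var; congruence.
  - split; [scoped_op; apply scoped_lift00; scoped_op|].
    eapply scoped_subst; [eassumption | apply substituted_ctx | eauto | eauto].
  - split; auto; scoped_op; apply (scoped_lift10 _ T); scoped_op.
    + apply scoped_lift00, scoped_wk; auto.
    + apply scoped_lift00; now constructor.
  - split; auto; scoped_op; apply scoped_lift00; scoped_op.
  - split; auto; scoped_op; apply scoped_lift00; scoped_op.
  - split; auto; scoped_op; apply scoped_lift00; scoped_op.
  - split; auto; scoped_op; apply scoped_lift00; scoped_op.
  - split.
    + scoped_op; apply (scoped_lift10 _ T); scoped_op.
    + eapply scoped_lock_unit; [eassumption | | eassumption].
      split; intros; simpl; auto; lia.
  - split; auto; scoped_op; apply scoped_lift01; scoped_op.
    apply (scoped_lift10 _ T).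
    eapply scoped_lock_counit; [eassumption | | | eassumption].
    + apply (inserted_ctx [] [cvar T; clock]).
    + repeat constructor.
Qed.

Lemma keys_eq_scoped G ts us :
  keys_eq G ts us -> Forall (scoped (locks_after G)) ts.
Proof. induction 1; constructor; auto; now apply eq_scoped in H. Qed.

Scheme wf_mut := Minimality for wf Sort Prop
  with has_type_mut := Minimality for has_type Sort Prop
  with keys_mut := Minimality for keys Sort Prop
  with eq_tm_mut := Minimality for eq_tm Sort Prop
  with keys_eq_mut := Minimality for keys_eq Sort Prop.

Combined Scheme judgements_ind from
  wf_mut, has_type_mut, keys_mut, eq_tm_mut, keys_eq_mut.

Scheme wf_typed_ind := Minimality for wf Sort Prop
  with has_type_wf_ind := Minimality for has_type Sort Prop.

(** Rules such as [ty_Sqrt] have premises only in an extended context, so the induction has to speak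
    about all suffixes. *)
Lemma typed_wf_suffix G a A :
  G ⊢ a ∈ A -> forall G1 G2, G = G1 ++ G2 -> wf G2.
Proof.
  revert G a A.
  apply (has_type_wf_ind
    (fun G => forall G1 G2, G = G1 ++ G2 -> wf G2)
    (fun G _ _ => forall G1 G2, G = G1 ++ G2 -> wf G2)); eauto.
  - intros [|e G1] G2 E; [|discriminate]; simpl in E; subst; constructor.
  - intros G A i H IH [|e G1] G2 E; simpl in E; subst; [now apply wf_cvar in H|].
    injection E as _ E; eauto.
  - intros G H IH [|e G1] G2 E; simpl in E; subst; [now constructor|].
    injection E as _ E; eauto.
  - intros G A i _ IH G1 G2 E; apply (IH (clock :: G1)); now rewrite E.
  - intros G A a _ IH G1 G2 E; apply (IH (clock :: G1)); now rewrite E.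
  - intros G A A' r _ IH _ G1 G2 E; apply (IH (cvar T :: G1)); now rewrite E.
Qed.

Lemma typed_wf G a A : G ⊢ a ∈ A -> wf G.
Proof. intros H; now apply (typed_wf_suffix G a A H []). Qed.

Lemma wf_suffix G1 G2 : wf (G1 ++ G2) -> wf G2.
Proof.
  intros H; assert (HT := ty_T _ H); now apply (typed_wf_suffix _ _ _ HT G1).
Qed.

Lemma lock_counit_nullary w ts v l o :
  arity o = [] -> lock_counit w ts v l (Op o []) (Op o []).
Proof. intros E; constructor; unfold under; rewrite E; constructor. Qed.

Lemma ty_key G1 G2 ts :
  wf (G1 ++ cvar T :: G2) -> length ts = nlocks G1 ->
  keys (G1 ++ cvar T :: G2) ts -> G1 ++ cvar T :: G2 ⊢ Var (nvars G1) ts ∈ T.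
Proof. intros; eapply ty_Var; eauto; now apply lock_counit_nullary. Qed.

Lemma eqt_key G1 G2 ts ts' :
  wf (G1 ++ cvar T :: G2) -> length ts = nlocks G1 ->
  keys_eq (G1 ++ cvar T :: G2) ts ts' ->
  G1 ++ cvar T :: G2 ⊢ Var (nvars G1) ts ≡ Var (nvars G1) ts' ∈ T.
Proof. intros; eapply eqt_Var; eauto; now apply lock_counit_nullary. Qed.

Fixpoint ren_ctx (w : nat) (ps : list nat) (v l : nat) (G : ctx) : ctx :=
  match G with
  | [] => []
  | cvar A :: G =>
      cvar (ren w ps (nvars G + v) (nlocks G + l) A) :: ren_ctx w ps v l G
  | clock :: G => clock :: ren_ctx w ps v l G
  end.

Lemma nvars_ren_ctx w ps v l G : nvars (ren_ctx w ps v l G) = nvars G.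
Proof. induction G as [|[A|] G IH]; simpl; auto. Qed.

Lemma nlocks_ren_ctx w ps v l G : nlocks (ren_ctx w ps v l G) = nlocks G.
Proof. induction G as [|[A|] G IH]; simpl; auto. Qed.

Lemma ren_ctx_app w ps v l G1 G2 :
  ren_ctx w ps v l (G1 ++ G2) =
  ren_ctx w ps (nvars G2 + v) (nlocks G2 + l) G1 ++ ren_ctx w ps v l G2.
Proof.
  induction G1 as [|[A|] G1 IH]; simpl; auto; [|now rewrite IH].
  now rewrite IH, nvars_app, nlocks_app, !Nat.add_assoc.
Qed.

Lemma wk_ren w ps v l a : ren w ps (S v) l (wk 1 a) = wk 1 (ren w ps v l a).
Proof. exact (shift_ren w ps 1 0 v l a). Qed.

Lemma keys_app G ts1 ts2 : keys G ts1 -> keys G ts2 -> keys G (ts1 ++ ts2).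
Proof. induction 1; simpl; auto; constructor; auto. Qed.

Lemma keys_app_inv G ts1 ts2 : keys G (ts1 ++ ts2) -> keys G ts1 /\ keys G ts2.
Proof.
  induction ts1; simpl; intros H; [split; [constructor|auto]|].
  inversion H; subst; destruct IHts1; auto; split; auto; constructor; auto.
Qed.

Lemma keys_eq_app G ts1 ts2 us1 us2 :
  keys_eq G ts1 us1 -> keys_eq G ts2 us2 -> keys_eq G (ts1 ++ ts2) (us1 ++ us2).
Proof. induction 1; simpl; auto; constructor; auto. Qed.

Lemma keys_eq_app_inv G ts1 ts2 us :
  keys_eq G (ts1 ++ ts2) us ->
  exists us1 us2, us = us1 ++ us2 /\ keys_eq G ts1 us1 /\ keys_eq G ts2 us2.
Proof.
  revert us; induction ts1; simpl; intros us H.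
  - exists [], us; repeat split; auto; constructor.
  - inversion H as [|? ? t' ? ts' Ht Hts]; subst.
    destruct (IHts1 _ Hts) as (us1 & us2 & -> & H1 & H2).
    exists (t' :: us1), us2; repeat split; auto; constructor; auto.
Qed.

Lemma keys_eq_length G ts us : keys_eq G ts us -> length ts = length us.
Proof. induction 1; simpl; auto. Qed.

Lemma app_cvar_cases (G1 G2 G3 G4 : ctx) (A : tm) :
  G1 ++ cvar A :: G2 = G3 ++ G4 ->
  (exists D, G3 = G1 ++ cvar A :: D /\ G2 = D ++ G4) \/
  (exists D, G1 = G3 ++ D /\ G4 = D ++ cvar A :: G2).
Proof.
  revert G3; induction G1 as [|e G1 IH]; intros [|e' G3] E; simpl in E.
  - right; exists []; auto.
  - injection E as <- E; left; exists G3; auto.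
  - right; exists (e :: G1); auto.
  - injection E as <- E; destruct (IH _ E) as [(D & -> & ->)|(D & -> & ->)].
    + left; exists D; auto.
    + right; exists D; auto.
Qed.

Definition T_vars (G : ctx) (ps : list nat) : Prop :=
  Forall (fun p => exists D1 D2, G = D1 ++ cvar T :: D2 /\
    nvars D1 = p /\ nlocks D1 = 0) ps.

Lemma keys_T_vars G D ps ks :
  T_vars G ps -> wf (D ++ G) -> length ks = nlocks D -> keys (D ++ G) ks ->
  keys (D ++ G) (map (fun p => Var (p + nvars D) ks) ps).
Proof.
  intros HT Hwf Hl Hk; induction HT as [|p ps (D1 & D2 & -> & <- & Hp) _ IH];
    simpl; constructor; auto.
  replace (nvars D1 + nvars D) with (nvars (D ++ D1)) by (rewrite nvars_app; lia).
  rewrite app_assoc in *.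
  apply ty_key; auto; rewrite nlocks_app; lia.
Qed.

Lemma keys_eq_T_vars G D ps ks ks' :
  T_vars G ps -> wf (D ++ G) -> length ks = nlocks D -> keys_eq (D ++ G) ks ks' ->
  keys_eq (D ++ G) (map (fun p => Var (p + nvars D) ks) ps)
    (map (fun p => Var (p + nvars D) ks') ps).
Proof.
  intros HT Hwf Hl Hk; induction HT as [|p ps (D1 & D2 & -> & <- & Hp) _ IH];
    simpl; constructor; auto.
  replace (nvars D1 + nvars D) with (nvars (D ++ D1)) by (rewrite nvars_app; lia).
  rewrite app_assoc in *.
  apply eqt_key; auto; rewrite nlocks_app; lia.
Qed.

Section preservation.
Variables (G' G0 : ctx) (ps : list nat).
Hypothesis ps_length : length ps = nlocks G'.
Hypothesis ps_T : T_vars (G' ++ G0) ps.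
Hypothesis wf_G' : wf (G' ++ G0).

Notation θ := (ren (nvars G') ps).
Notation θctx := (ren_ctx (nvars G') ps 0 0).

Let ps_locks : Forall (fun p => locks_after (G' ++ G0) p = 0) ps.
Proof.
  eapply Forall_impl; [|apply ps_T]; simpl; intros p (D1 & D2 & -> & <- & H).
  now rewrite locks_after_var.
Qed.

(** The split of the context is quantified inside the motives, so that passing under a binder
    extends [D] while [G0] stays fixed. *)
Let Pwf G := forall D, G = D ++ G0 -> wf (θctx D ++ G' ++ G0).
Let Pty G a A := forall D, G = D ++ G0 ->
  θctx D ++ G' ++ G0 ⊢ θ (nvars D) (nlocks D) a ∈ θ (nvars D) (nlocks D) A.
Let Pkeys G ts := forall D, G = D ++ G0 ->
  keys (θctx D ++ G' ++ G0) (map (θ (nvars D) (nlocks D)) ts).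
Let Peq G a b A := forall D, G = D ++ G0 ->
  θctx D ++ G' ++ G0 ⊢ θ (nvars D) (nlocks D) a ≡ θ (nvars D) (nlocks D) b
    ∈ θ (nvars D) (nlocks D) A.
Let Pkeys_eq G ts us := forall D, G = D ++ G0 ->
  keys_eq (θctx D ++ G' ++ G0) (map (θ (nvars D) (nlocks D)) ts)
    (map (θ (nvars D) (nlocks D)) us).

(** The image of a variable, in a form that serves both its typing and its
    congruence rule: [K] is the action on lists of keys. *)
Let ren_Var G1 A G2 ts A' D :
  G1 ++ cvar A :: G2 = D ++ G0 ->
  wf (G1 ++ cvar A :: G2) -> wf (θctx D ++ G' ++ G0) ->
  length ts = nlocks G1 ->
  Forall (scoped (locks_after (G1 ++ cvar A :: G2))) ts ->
  lock_counit (S (nvars G1)) ts 0 0 A A' ->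
  let Δ := θctx D ++ G' ++ G0 in
  let θ' := θ (nvars D) (nlocks D) in
  exists H1 B H2 (K : list tm -> list tm),
    Δ = H1 ++ cvar B :: H2 /\
    lock_counit (S (nvars H1)) (K ts) 0 0 B (θ' A') /\
    length (K ts) = nlocks H1 /\
    (forall us, length us = length ts ->
       θ' (Var (nvars G1) us) = Var (nvars H1) (K us)) /\
    (keys Δ (map θ' ts) -> keys Δ (K ts)) /\
    (forall us, keys_eq Δ (map θ' ts) (map θ' us) -> keys_eq Δ (K ts) (K us)).
Proof.
  intros E Hwf HΔ Hts Hsc HA Δ θ'.
  destruct (app_cvar_cases _ _ _ _ _ E) as [(D' & -> & ->)|(D' & -> & E0)].
  (* The variable lies in [D], to the right of [G']: it keeps its index and its number of keys. *)
  - exists (ren_ctx (nvars G') ps (S (nvars D')) (nlocks D') G1),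
      (θ (nvars D') (nlocks D') A), (θctx D' ++ G' ++ G0), (map θ').
    unfold Δ; rewrite ren_ctx_app; simpl.
    rewrite !Nat.add_0_r, <- app_assoc; simpl.
    rewrite nvars_ren_ctx, nlocks_ren_ctx, length_map.
    repeat split; auto.
    + apply (lock_counit_ren (nvars G') ps) with (v0 := nvars D') (l0 := nlocks D') in HA.
      unfold θ'; rewrite nvars_app, nlocks_app; simpl.
      rewrite <- plus_n_Sm, <- Hts; exact HA.
    + intros us _; apply ren_bound; rewrite nvars_app; simpl; lia.
  (* The variable lies in [G0]: its last [nlocks D] keys belong to the locks of [D], and the keys
     for the locks of [G'] go in front of them. *)
  - pose (K := fun us : list tm =>
      let k := length us - nlocks D in
      map θ' (firstn k us) ++
      map (fun p => Var (p + nvars D) (map θ' (skipn k us))) ps ++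
      map θ' (skipn k us)).
    exists (θctx D ++ G' ++ D'), A, G2, K.
    assert (HL : forall us : list tm, length us = length ts ->
      length (firstn (length us - nlocks D) us) = nlocks D' /\
      length (skipn (length us - nlocks D) us) = nlocks D).
    { intros us Hus; rewrite nlocks_app in Hts.
      rewrite length_firstn, length_skipn; lia. }
    unfold Δ; rewrite E0 at 1.
    rewrite !nvars_app, !nlocks_app, nvars_ren_ctx, nlocks_ren_ctx.
    repeat split.
    + now rewrite <- !app_assoc.
    (* The counit in the type of the variable inserts everything to its right, so the place of [G']
       lies inside the inserted part. *)
    + assert (H := lock_counit_ren_inside (nvars G') ps _ _ _ _ _ _ HA
        (nvars D) (nlocks D) (firstn (length ts - nlocks D) ts)
        (skipn (length ts - nlocks D) ts)
        (locks_after G2) (locks_after (D ++ G0)) (locks_after (D ++ G0))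
        (locks_after (D ++ G' ++ G0)) (locks_after (G' ++ G0))).
      cbv zeta in H; rewrite nvars_app in H; unfold K; cbv zeta.
      replace (S (nvars D + (nvars G' + nvars D')))
        with (S (nvars D + nvars D') + nvars G') by lia.
      apply H; try lia.
      * now rewrite firstn_skipn.
      * now apply HL.
      * rewrite E0, Hts.
        assert (Hi := inserted_ctx [] ((D ++ D') ++ [cvar A]) G2).
        rewrite nvars_app, nlocks_app, nvars_app in Hi; simpl in Hi.
        rewrite !Nat.add_0_r, Nat.add_1_r, <- !app_assoc in Hi; exact Hi.
      * rewrite ps_length; apply inserted_ctx.
      * exact ps_locks.
      * now rewrite <- E.
      * apply wf_suffix in Hwf; inversion Hwf; eapply typed_scoped; eassumption.
    + destruct (HL ts eq_refl) as [L1 L2].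
      unfold K; rewrite !length_app, !length_map, L1, L2; lia.
    + intros us Hus; destruct (HL us Hus) as [L1 L2].
      rewrite <- (firstn_skipn (length us - nlocks D) us) at 1.
      unfold θ'; rewrite ren_free; [|lia|rewrite length_app; lia].
      unfold K; f_equal; lia.
    + intros Hk; destruct (HL ts eq_refl) as [L1 L2].
      rewrite <- (firstn_skipn (length ts - nlocks D) ts), map_app in Hk.
      apply keys_app_inv in Hk as [Hj Hk].
      unfold K; cbv zeta; rewrite <- (nvars_ren_ctx (nvars G') ps 0 0 D).
      repeat apply keys_app; auto.
      apply keys_T_vars; auto.
      now rewrite length_map, nlocks_ren_ctx.
    + intros us Hk; assert (Hl := keys_eq_length _ _ _ Hk).
      rewrite !length_map in Hl.
      destruct (HL ts eq_refl) as [L1 L2], (HL us (eq_sym Hl)) as [L3 L4].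
      rewrite <- (firstn_skipn (length ts - nlocks D) ts) in Hk.
      rewrite <- (firstn_skipn (length us - nlocks D) us), !map_app in Hk.
      apply keys_eq_app_inv in Hk as (js' & ks' & Ek & Hj & Hk).
      apply app_eq_app_length in Ek as [<- <-];
        [|rewrite <- (keys_eq_length _ _ _ Hj), !length_map; lia].
      unfold K; cbv zeta; rewrite <- (nvars_ren_ctx (nvars G') ps 0 0 D).
      repeat apply keys_eq_app; auto.
      apply keys_eq_T_vars; auto.
      now rewrite length_map, nlocks_ren_ctx.
Qed.

Ltac spec H :=
  match type of H with
  | Pwf _ => unfold Pwf in H | Pty _ _ _ => unfold Pty in H
  | Pkeys _ _ => unfold Pkeys in H
  | Peq _ _ _ _ => unfold Peq in H
  | Pkeys_eq _ _ _ => unfold Pkeys_eq in H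
  end;
  match type of H with
  | forall D', ?e1 :: ?e2 :: ?D ++ G0 = _ -> _ => specialize (H (e1 :: e2 :: D) eq_refl)
  | forall D', ?e1 :: ?D ++ G0 = _ -> _ => specialize (H (e1 :: D) eq_refl)
  | forall D', ?D ++ G0 = _ -> _ => specialize (H D eq_refl)
  end;
  cbn in H; rewrite ?Nat.add_0_r, ?wk_ren in H.

Ltac push_ren :=
  intros; intros D E; subst;
  repeat match goal with
  | H : Pwf _ |- _ => spec H | H : Pty _ _ _ |- _ => spec H
  | H : Pkeys _ _ |- _ => spec H | H : Peq _ _ _ _ |- _ => spec H
  | H : Pkeys_eq _ _ _ |- _ => spec H
  end;
  repeat match goal with
  | H : subst _ ?v ?l _ _ |- _ =>
      apply (subst_ren (nvars G') ps _ (nvars D) (nlocks D)) in H;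
      cbn in H; revert H
  | H : lock_unit ?v ?l _ _ |- _ =>
      apply (lock_unit_ren (nvars G') ps (nvars D) (nlocks D)) in H;
      cbn in H; revert H
  | H : lock_counit _ _ _ _ _ _ |- _ =>
      apply (lock_counit_ren (nvars G') ps) with (v0 := nvars D) (l0 := nlocks D) in H;
      cbn in H; revert H
  end;
  cbn; rewrite ?wk_ren; intros.

Ltac case_with rule := push_ren; eapply rule; eauto.

(** Apart from the variable rules, handled by [ren_Var], each rule is reapplied in the new context:
    [ren] commutes with the graphs among its premises and with the weakenings that it mentions. *)
Lemma preservation :
  (forall G, wf G -> Pwf G) /\
  (forall G a A, G ⊢ a ∈ A -> Pty G a A) /\
  (forall G ts, keys G ts -> Pkeys G ts) /\
  (forall G a b A, G ⊢ a ≡ b ∈ A -> Peq G a b A) /\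
  (forall G ts us, keys_eq G ts us -> Pkeys_eq G ts us).
Proof.
  apply judgements_ind.
  - intros [|? ?] E; [|discriminate]; simpl in *; subst; auto.
  - intros G A i _ IH [|e D] E; simpl in *; [subst; auto|].
    injection E as <- ->; simpl; rewrite !Nat.add_0_r.
    eapply wf_cvar; now apply (IH D).
  - intros G _ IH [|e D] E; simpl in *; [subst; auto|].
    injection E as <- ->; simpl; constructor; now apply IH.
  - case_with ty_conv.
  - intros G2 A G1 ts A' Hwf IHwf Hl Hk IHk HA D E.
    destruct (ren_Var G1 A G2 ts A' D) as
      (H1 & B & H2 & K & EΔ & Hc & HlK & HV & HK & _);
      auto; [now apply keys_scoped|].
    rewrite HV by auto; specialize (HK (IHk D E)).
    specialize (IHwf D E); rewrite EΔ in *; now apply ty_Var.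
  - case_with ty_U.
  - case_with ty_T.
  - case_with ty_Pi.
  - case_with ty_Lam.
  - case_with ty_App.
  - case_with ty_Sig.
  - case_with ty_Pair.
  - case_with ty_Fst.
  - case_with ty_Snd.
  - case_with ty_Id.
  - case_with ty_Refl.
  - push_ren.
    match goal with H : ?Γ ⊢ _ ∈ Id ?A ?a ?b |- ?Γ ⊢ _ ∈ _ =>
      eapply (ty_J _ A a b) end; eauto.
  - case_with ty_Sqrt.
  - case_with ty_Lock.
  - case_with ty_Ev.
  - intros G D E; constructor.
  - intros G t ts _ IHt _ IHts D E; constructor; [apply (IHt D E)|auto].
  - case_with eqt_refl.
  - case_with eqt_sym.
  - case_with eqt_trans.
  - case_with eqt_conv.
  - intros G2 A G1 ts us A' Hwf IHwf Hl Hk IHk HA D E.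
    assert (Hlen := keys_eq_length _ _ _ Hk).
    destruct (ren_Var G1 A G2 ts A' D) as
      (H1 & B & H2 & K & EΔ & Hc & HlK & HV & _ & HK);
      auto; [now apply (keys_eq_scoped _ _ _ Hk)|].
    rewrite !HV by auto; specialize (HK us (IHk D E)).
    specialize (IHwf D E); rewrite EΔ in *; now apply eqt_Var.
  - case_with eqt_Pi.
  - case_with eqt_Lam.
  - case_with eqt_App.
  - case_with eqt_Sig.
  - case_with eqt_Pair.
  - case_with eqt_Fst.
  - case_with eqt_Snd.
  - case_with eqt_Id.
  - case_with eqt_Refl.
  - push_ren.
    match goal with H : ?Γ ⊢ _ ≡ _ ∈ Id ?A ?a ?b |- ?Γ ⊢ _ ≡ _ ∈ _ =>
      eapply (eqt_J _ A a b) end; eauto.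
  - case_with eqt_Sqrt.
  - case_with eqt_Lock.
  - case_with eqt_Ev.
  - case_with eqt_Pi_beta.
  - case_with eqt_Pi_eta.
  - case_with eqt_Fst_beta.
  - case_with eqt_Snd_beta.
  - case_with eqt_Sig_eta.
  - case_with eqt_J_beta.
  - case_with eqt_Sqrt_beta.
  - case_with eqt_Sqrt_eta.
  - intros G D E; constructor.
  - intros G t t' ts ts' _ IHt _ IHts D E; constructor; [apply (IHt D E)|auto].
Qed.

Lemma ty_ren a A :
  G0 ⊢ a ∈ A -> G' ++ G0 ⊢ ren (nvars G') ps 0 0 a ∈ ren (nvars G') ps 0 0 A.
Proof. intros H; exact (proj1 (proj2 preservation) _ _ _ H [] eq_refl). Qed.
End preservation.

Lemma ty_wk G C i a A :
  G ⊢ C ∈ U i -> G ⊢ a ∈ A -> cvar C :: G ⊢ wk 1 a ∈ wk 1 A.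
Proof.
  intros HC Ha; rewrite <- !(ren_no_keys 1 0 0).
  apply (ty_ren [cvar C]); try constructor; auto.
  now apply wf_cvar with i.
Qed.

(** * The equivalence for variables A and B *)

Lemma lock_counit_eq w ts v l a a1 a2 :
  lock_counit w ts v l a a1 -> a1 = a2 -> lock_counit w ts v l a a2.
Proof. now intros H <-. Qed.

Lemma subst_eq_r a v l b b1 b2 :
  subst a v l b b1 -> b1 = b2 -> subst a v l b b2.
Proof. now intros H <-. Qed.

Lemma lock_unit_eq_r v l a a1 a2 :
  lock_unit v l a a1 -> a1 = a2 -> lock_unit v l a a2.
Proof. now intros H <-. Qed.

Lemma ty_Pi_max G A B i j k :
  G ⊢ A ∈ U i -> cvar A :: G ⊢ B ∈ U j -> k = max i j -> G ⊢ Pi A B ∈ U k.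
Proof. intros ? ? ->; now apply ty_Pi. Qed.

Lemma ty_Sig_max G A B i j k :
  G ⊢ A ∈ U i -> cvar A :: G ⊢ B ∈ U j -> k = max i j -> G ⊢ Sig A B ∈ U k.
Proof. intros ? ? ->; now apply ty_Sig. Qed.

Lemma eqt_Pi_eta_eq G A B f f' :
  G ⊢ f ∈ Pi A B -> f' = Lam (App (wk 1 f) (var 0)) -> G ⊢ f ≡ f' ∈ Pi A B.
Proof. intros ? ->; now apply eqt_Pi_eta. Qed.

(** Runs the clauses as a program. Lists of keys are split explicitly because unification cannot
    split at [++]. On an opaque term the answer comes from a hypothesis or, for a renamed term under
    substitution, from [subst_ren_cancel]. *)
Ltac graph :=
  lazymatch goal with
  | |- lock_counit ?w ?ts ?v ?l (Var ?n ?us) _ =>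
      lazymatch eval cbv in (n <? v) with
      | true => eapply lock_counit_bound; [apply Nat.ltb_lt; reflexivity | graph]
      | false =>
          let js := eval cbv in (firstn (length us - l) us) in
          let ks := eval cbv in (skipn (length us - l) us) in
          refine (lock_counit_free w ts v l n js _ ks _ _ _ _ _ _ _);
          [apply Nat.leb_le; reflexivity | reflexivity | graph | graph | graph]
      end
  | |- lock_counit _ _ _ _ (Op _ _) _ =>
      eapply lock_counit_op; graph
  | |- lock_counit _ _ _ _ _ _ => solve [auto]
  | |- lock_counits ?w ?ts ?bs ?args _ =>
      lazymatch eval hnf in args with
      | nil => apply lock_counits_nil
      | _ => cbn [under arity everywhere map fst snd Nat.add];
             eapply lock_counits_cons; [graph | graph]
      end
  | |- subst ?a ?v ?l (Var ?n ?ks) _ =>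
      lazymatch eval cbv in (n <? v) with
      | true => eapply subst_lt; [apply Nat.ltb_lt; reflexivity | graph]
      | false =>
        lazymatch eval cbv in (n =? v) with
        | true => eapply subst_eq; [reflexivity | graph | graph]
        | false => eapply subst_gt; [apply Nat.leb_le; reflexivity | graph]
        end
      end
  | |- subst _ _ _ (Op _ _) _ => eapply subst_op; graph
  | |- subst _ _ _ (ren _ _ _ _ _) _ =>
      eapply subst_ren_cancel; [eassumption | lia | once (repeat constructor)]
  | |- substs ?a ?bs ?args _ =>
      lazymatch eval hnf in args with
      | nil => apply substs_nil
      | _ => cbn [under arity everywhere map fst snd Nat.add];
             eapply substs_cons; [graph | graph]
      end
  | |- lock_unit ?v ?l (Var ?n ?ks) _ =>
      lazymatch eval cbv in (n <? v) with
      | true => eapply lock_unit_lt; [apply Nat.ltb_lt; reflexivity | graph]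
      | false =>
        lazymatch eval cbv in (n =? v) with
        | true => eapply lock_unit_eq; [reflexivity | graph]
        | false =>
            let n' := eval cbv in (pred n) in
            let k := eval cbv in (length ks - S l) in
            let js := eval cbv in (firstn k ks) in
            lazymatch eval cbv in (skipn k ks) with
            | ?t :: ?ks' =>
                refine (lock_unit_gt v l n' js _ t ks' _ _ _ _ _);
                [apply Nat.leb_le; reflexivity | reflexivity | graph | graph]
            end
        end
      end
  | |- lock_unit _ _ (Op _ _) _ => eapply lock_unit_op; graph
  | |- lock_units ?bs ?args _ =>
      lazymatch eval hnf in args with
      | nil => apply lock_units_nil
      | _ => cbn [under arity everywhere map fst snd Nat.add];
             eapply lock_units_cons; [graph | graph]
      end
  end.

(** Solves a counit, substitution or unit goal, also when its result is still an
    existential variable, which it instantiates with a normal form. *)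
Ltac compute_graph :=
  cbn;
  lazymatch goal with
  | |- lock_counit _ _ _ _ _ _ => eapply lock_counit_eq
  | |- subst _ _ _ _ _ => eapply subst_eq_r
  | |- lock_unit _ _ _ _ => eapply lock_unit_eq_r
  end; [graph | cbn; reflexivity].

Ltac split_ctx G n k :=
  lazymatch G with
  | cvar ?A :: ?G' =>
      lazymatch n with
      | 0 => k (@nil entry) A G'
      | S ?m => split_ctx G' m ltac:(fun G1 B G0 => k (cvar A :: G1) B G0)
      end
  | clock :: ?G' => split_ctx G' n ltac:(fun G1 B G0 => k (clock :: G1) B G0)
  end.

Ltac typ :=
  lazymatch goal with
  | |- ?G ⊢ _ ∈ _ =>
      lazymatch goal with
      | _ : wf G |- _ => idtac
      | _ => assert (wf G) by typ
      end
  | _ => idtac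
  end;
  lazymatch goal with
  | |- wf _ => first [assumption | apply wf_clock; typ | eapply wf_cvar; typ]
  | |- keys _ [] => apply keys_nil
  | |- keys _ _ => apply keys_cons; [typ | typ]
  | |- ?G ⊢ Var ?n ?ts ∈ _ =>
      split_ctx G n ltac:(fun G1 A G0 =>
        refine (ty_Var G0 A G1 ts _ _ _ _ _); cbn [app]; [typ | reflexivity | typ | compute_graph])
  | |- _ ⊢ U _ ∈ _ => apply ty_U; typ
  | |- _ ⊢ T ∈ _ => apply ty_T; typ
  | |- _ ⊢ Pi _ _ ∈ _ => eapply ty_Pi_max; [typ | typ | reflexivity]
  | |- _ ⊢ Sig _ _ ∈ _ => eapply ty_Sig_max; [typ | typ | reflexivity]
  | |- _ ⊢ Id _ _ _ ∈ _ => eapply ty_Id; [typ | typ | typ]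
  | |- _ ⊢ Sqrt _ ∈ _ => eapply ty_Sqrt; typ
  (* A λ carries no domain, so the type of an applied λ has to come from a hypothesis. *)
  | |- _ ⊢ Lam _ ∈ _ => first [eassumption | eapply ty_Lam; [typ | typ]]
  | |- _ ⊢ Lock _ ∈ _ => eapply ty_Lock; typ
  | |- _ ⊢ App _ _ ∈ _ => eapply ty_App; [typ | typ | compute_graph]
  | |- _ ⊢ Ev _ ∈ _ => eapply ty_Ev; [typ | compute_graph]
  end.

Ltac beta A B :=
  eapply (eqt_Pi_beta _ A B); [| | typ | |];
  [typ | typ | compute_graph | compute_graph].

Section generic.
Variables (G : ctx) (i j : nat).
Hypothesis HG : wf G.

Notation fwd := (Lam (Lam (Lock (App (Ev (Var 2 [var 0])) (Lam (Var 1 [var 0])))))).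
Notation bwd := (Lam (Lock (Lam (Ev (App (Var 2 [var 0]) (App (var 1) (var 0))))))).
Let Γ := cvar (Sqrt (U j)) :: cvar (U i) :: G.
Notation X := (Sqrt (Arr (Pi T (Var 2 [var 0])) (Ev (Var 1 [var 0])))).
Notation Y := (Pi (var 1) (Sqrt (Ev (Var 2 [var 0])))).

Lemma generic_wf : wf Γ.
Proof. unfold Γ. typ. Qed.

Lemma generic_X : Γ ⊢ X ∈ U (max i j).
Proof. assert (H := generic_wf); unfold Γ, Arr in *; cbn. typ. Qed.

Lemma generic_Y : Γ ⊢ Y ∈ U (max i j).
Proof. assert (H := generic_wf); unfold Γ, Arr in *; cbn. typ. Qed.

Lemma fwd_typed : Γ ⊢ fwd ∈ Arr X Y.
Proof. assert (H := generic_wf); unfold Γ, Arr in *; cbn. typ. Qed.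

Lemma bwd_typed : Γ ⊢ bwd ∈ Arr Y X.
Proof. assert (H := generic_wf); unfold Γ, Arr in *; cbn. typ. Qed.

Lemma bwd_fwd :
  cvar X :: Γ ⊢ App bwd (App fwd (var 0)) ≡ var 0 ∈ wk 1 X.
Proof.
  assert (H := generic_wf); unfold Γ, Arr in *; cbn.
  assert (HX : wf (cvar X :: Γ)) by (eapply wf_cvar, generic_X).
  unfold Γ, Arr in *; cbn in HX.
  eapply eqt_trans with (b := App bwd
    (Lam (Lock (App (Ev (Var 2 [var 0])) (Lam (Var 1 [var 0])))))).
  { eapply eqt_App with (A := Pi (var 2) (Sqrt (Ev (Var 3 [var 0]))))
      (B := Sqrt (Pi (Pi T (Var 4 [var 0])) (Ev (Var 4 [var 0])))).
    - apply eqt_refl; typ.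
    - beta uconstr:(_) (Pi (var 3) (Sqrt (Ev (Var 4 [var 0])))).
    - compute_graph. }
  (* A term containing [f<i'/L'>] replaces [g<i/L>]. The result contains [f<i<i'/L'>/L, i'/L'>],
     because the key of the outer lock is itself subjected to a counit. *)
  eapply eqt_trans with (b := Lock (Lam (Ev (App
    (Lam (Lock (App (Ev (Var 4 [Var 2 [var 0]; var 0])) (Lam (Var 1 [var 0])))))
    (App (var 1) (var 0)))))).
  { beta (Pi (var 2) (Sqrt (Ev (Var 3 [var 0]))))
      (Sqrt (Pi (Pi T (Var 4 [var 0])) (Ev (Var 4 [var 0])))). }
  (* The right-hand side is now expanded, by √η and then, under the lock, by Πη. *)
  eapply eqt_trans with (b := Lock (Ev (Var 1 [var 0]))).
  2: { apply eqt_sym; eapply eqt_Sqrt_eta; [typ | compute_graph]. }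
  apply eqt_Lock.
  eapply eqt_trans with (b := Lam (App (Ev (Var 2 [var 0])) (var 0))).
  2: { apply eqt_sym; eapply eqt_Pi_eta_eq; [typ | reflexivity]. }
  eapply eqt_Lam; [typ|].
  eapply eqt_trans with (b := Ev (Lock (App (Ev (Var 3 [Var 1 [var 0]; var 0]))
    (Lam (App (Var 2 [var 0]) (Var 1 [var 0])))))).
  { eapply eqt_Ev; [beta uconstr:(_) uconstr:(_) | compute_graph]. }
  (* The unit sends [i<t/L'>] to [t], so the argument becomes [λt. α t], and [f<i<i'/L'>/L, i'/L'>]
     becomes [f<i'/L>]. *)
  eapply eqt_trans with (b := App (Ev (Var 2 [var 0])) (Lam (App (var 1) (var 0)))).
  { eapply eqt_Sqrt_beta; [typ | compute_graph | compute_graph]. }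
  eapply eqt_App; [apply eqt_refl; typ | | compute_graph].
  apply eqt_sym; eapply eqt_Pi_eta_eq; [typ | reflexivity].
Qed.

Lemma fwd_bwd :
  cvar Y :: Γ ⊢ App fwd (App bwd (var 0)) ≡ var 0 ∈ wk 1 Y.
Proof.
  assert (H := generic_wf); unfold Γ, Arr in *; cbn.
  assert (HY : wf (cvar Y :: Γ)) by (eapply wf_cvar, generic_Y).
  unfold Γ in *.
  eapply eqt_trans with (b := App fwd
    (Lock (Lam (Ev (App (Var 2 [var 0]) (App (var 1) (var 0))))))).
  { eapply eqt_App with (A := Sqrt (Pi (Pi T (Var 3 [var 0])) (Ev (Var 3 [var 0]))))
      (B := Pi (var 3) (Sqrt (Ev (Var 4 [var 0])))).
    - apply eqt_refl; typ.
    - beta uconstr:(_) (Sqrt (Pi (Pi T (Var 4 [var 0])) (Ev (Var 4 [var 0])))).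
    - compute_graph. }
  eapply eqt_trans with (b := Lam (Lock (App
    (Ev (Lock (Lam (Ev (App (Var 4 [Var 2 [var 0]; var 0]) (App (var 1) (var 0)))))))
    (Lam (Var 1 [var 0]))))).
  { beta (Sqrt (Pi (Pi T (Var 3 [var 0])) (Ev (Var 3 [var 0]))))
      (Pi (var 3) (Sqrt (Ev (Var 4 [var 0])))). }
  eapply eqt_trans with (b := Lam (App (var 1) (var 0))).
  2: { apply eqt_sym; eapply eqt_Pi_eta_eq; [typ | reflexivity]. }
  eapply eqt_Lam; [typ|].
  eapply eqt_trans with (b := Lock (Ev (App (Var 2 [var 0]) (Var 1 [var 0])))).
  2: { apply eqt_sym; eapply eqt_Sqrt_eta; [typ | compute_graph]. }
  eapply eqt_Lock.
  eapply eqt_trans with (b := App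
    (Lam (Ev (App (Var 3 [var 0]) (App (var 1) (var 0))))) (Lam (Var 1 [var 0]))).
  { eapply eqt_App with (A := Pi T (Var 4 [var 0])) (B := Ev (Var 4 [var 0])).
    (* The type before the unit cannot be read off from its image, so it is given, with the two keys
       of A and B for the two locks. *)
    - eapply eqt_Sqrt_beta with
        (A := Pi (Pi T (Var 5 [Var 1 [var 0]; var 0])) (Ev (Var 5 [Var 2 [var 0]; var 0])));
        [typ | compute_graph | compute_graph].
    - apply eqt_refl; typ.
    - compute_graph. }
  (* Here α has become [λt. a<t/L>]; applying it to [i] leaves [a<i/L>], as in the √η-expansion of
     [g a]. *)
  eapply eqt_trans with
    (b := Ev (App (Var 2 [var 0]) (App (Lam (Var 2 [var 0])) (var 0)))).
  { beta (Pi T (Var 4 [var 0])) (Ev (Var 4 [var 0])). }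
  eapply eqt_Ev.
  - eapply eqt_App; [apply eqt_refl; typ | | compute_graph].
    beta uconstr:(_) (Var 5 [var 0]).
  - compute_graph.
Qed.

Notation equiv :=
  (Pair fwd (Pair (Pair bwd (Lam (Refl (var 0)))) (Pair bwd (Lam (Refl (var 0)))))).

Lemma equiv_typed : Γ ⊢ equiv ∈ Equiv X Y.
Proof.
  assert (H := generic_wf); assert (Hf := fwd_typed); assert (Hb := bwd_typed).
  assert (HX := generic_X); assert (HY := generic_Y).
  assert (HbX := bwd_fwd); assert (HfY := fwd_bwd).
  assert (HX' := wf_cvar _ _ _ HX); assert (HY' := wf_cvar _ _ _ HY).
  assert (HYX : Γ ⊢ Arr Y X ∈ U (max (max i j) (max i j))).
  { unfold Γ, Arr in *; cbn; typ. }
  (* Substituting [fwd] into the type of the inverses makes applied λ-terms appear in it. Their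
     typing is recorded for each context in which they occur, for [typ] to find. *)
  assert (Hf1 := ty_wk _ _ _ _ _ HYX Hf).
  assert (HfY' := ty_wk _ _ _ _ _ (ty_wk _ _ _ _ _ HYX HY) Hf1).
  assert (HfX' := ty_wk _ _ _ _ _ (ty_wk _ _ _ _ _ HYX HX) Hf1).
  assert (HS : exists k, Γ ⊢ Sig (Arr Y X) (Pi (wk 1 Y)
    (Id (wk 2 Y) (App fwd (App (var 1) (var 0))) (var 0))) ∈ U k).
  { unfold Γ, Arr in *; cbn in *; eexists; typ. }
  destruct HS as [k HS].
  assert (HYX1 := ty_wk _ _ _ _ _ HS HYX).
  assert (HX2 := ty_wk _ _ _ _ _ HYX1 (ty_wk _ _ _ _ _ HS HX)).
  assert (Hf2 := ty_wk _ _ _ _ _ HX2 (ty_wk _ _ _ _ _ HYX1 (ty_wk _ _ _ _ _ HS Hf))).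
  unfold Γ, Equiv, IsEquiv, Prod, Arr in *; cbn in *.
  eapply ty_Pair; [typ | exact Hf | compute_graph |].
  eapply ty_Pair; [typ | | compute_graph |];
    (eapply ty_Pair; [typ | exact Hb | compute_graph | eapply ty_Lam; [typ|]]).
  - eapply ty_conv; [apply ty_Refl; typ|].
    eapply eqt_Id; [apply eqt_refl; typ | apply eqt_sym; exact HfY |].
    apply eqt_refl; typ.
  - eapply ty_conv; [apply ty_Refl; typ|].
    eapply eqt_Id; [apply eqt_refl; typ | apply eqt_sym; exact HbX |].
    apply eqt_refl; typ.
Qed.

Lemma equiv_abstracted :
  G ⊢ Lam (Lam equiv) ∈ Pi (U i) (Pi (Sqrt (U j)) (Equiv X Y)).
Proof.
  eapply ty_Lam; [typ|]; eapply ty_Lam; [typ|]; exact equiv_typed.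
Qed.
End generic.

(** * Instantiation at the given A and B *)

Lemma shift_ren_top c k w ps a :
  c <= w ->
  shift k c (ren w ps 0 0 a) =
  ren (w + k) (map (fun p => if p <? c then p else p + k) ps) 0 0 a.
Proof. exact (fun H => shift_ren_inside c k w ps a 0 0 H). Qed.

(* A1 and B1 are A<t/L> and B<i/L> in G, lock_L, t : T (resp. i : T);
   B2 is B<i/L> in G, a : A, lock_L, i : T *)
Theorem proposition3p13 (G : ctx) (i j : nat) (A B : tm)
  (HA : G ⊢ A ∈ U i) (HB : G ⊢ B ∈ Sqrt (U j)) :
  exists A1 B1 B2 : tm,
    lock_counit 1 [var 0] 0 0 A A1 /\
    lock_counit 1 [var 0] 0 0 B B1 /\
    lock_counit 2 [var 0] 0 0 B B2 /\
    let X := Sqrt (Arr (Pi T A1) (Ev B1)) in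
    let Y := Pi A (Sqrt (Ev B2)) in
    G ⊢ X ∈ U (max i j) /\
    G ⊢ Y ∈ U (max i j) /\
    exists e : tm, G ⊢ e ∈ Equiv X Y.
Proof.
  assert (HG := typed_wf _ _ _ HA).
  assert (HsA := typed_scoped _ _ _ HA); assert (HsB := typed_scoped _ _ _ HB).
  (* These are the counits that substituting A and B for the two variables calls for, with no key or
     with the innermost variable as key; [graph] finds them as hypotheses. *)
  assert (A_wk : forall w, lock_counit w [] 0 0 A (ren w [] 0 0 A))
    by (intros w; now apply (ren_graph_top w [] A (locks_after G))).
  assert (B_wk : forall w, lock_counit w [] 0 0 B (ren w [] 0 0 B))
    by (intros w; now apply (ren_graph_top w [] B (locks_after G))).
  assert (A_key : forall w, lock_counit (S w) [var 0] 0 0 A (ren (S w) [0] 0 0 A))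
    by (intros w; apply (ren_graph_top (S w) [0] A (locks_after G));
        [assumption | constructor; [lia | constructor]]).
  assert (B_key : forall w, lock_counit (S w) [var 0] 0 0 B (ren (S w) [0] 0 0 B))
    by (intros w; apply (ren_graph_top (S w) [0] B (locks_after G));
        [assumption | constructor; [lia | constructor]]).
  assert (wf_G1 : wf (cvar T :: clock :: G)) by typ.
  assert (wf_G2 : wf (cvar T :: clock :: cvar A :: G)).
  { apply (wf_cvar _ _ 0), ty_T, wf_clock; now apply wf_cvar with i. }
  assert (HT : forall G', T_vars (cvar T :: G') [0]).
  { intros G'; constructor; [now exists [], G' | constructor]. }
  assert (HA1 := ty_ren [cvar T; clock] G [0] eq_refl (HT _) wf_G1 _ _ HA).
  assert (HB1 := ty_ren [cvar T; clock] G [0] eq_refl (HT _) wf_G1 _ _ HB).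
  assert (HB2 := ty_ren [cvar T; clock; cvar A] G [0] eq_refl (HT _) wf_G2 _ _ HB).
  assert (HP : clock :: G ⊢ Pi T (ren 1 [0] 0 0 A) ∈ U i).
  { eapply ty_Pi_max; [apply ty_T; now constructor | exact HA1 | reflexivity]. }
  exists (ren 1 [0] 0 0 A), (ren 1 [0] 0 0 B), (ren 2 [0] 0 0 B).
  repeat split; auto; intros.
  - apply ty_Sqrt, ty_Pi; [exact HP|].
    apply (ty_wk _ _ _ (Ev (ren 1 [0] 0 0 B)) (U j) HP).
    eapply ty_Ev; [exact HB1 | compute_graph].
  - apply ty_Pi; [exact HA|]; apply ty_Sqrt.
    eapply ty_Ev; [exact HB2 | compute_graph].
  - eexists; eapply ty_App; [eapply ty_App | exact HB |].
    + exact (equiv_abstracted G i j HG).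
    + exact HA.
    + unfold Equiv, IsEquiv, Prod, Arr; compute_graph.
    + unfold Equiv, IsEquiv, Prod, Arr; cbn.
      (* Iterated weakenings of A and of the renamed A and B merge into single renamings, the form
         that cancellation of the substitution produces. *)
      rewrite <- !(ren_no_keys 1 0 0 A), !shift_ren_top by lia.
      compute_graph.
Qed.
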